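(* Let $d\geq 2$, $L\geq4$, and let $A_1,\ldots,A_d\subset\{0,\ldots,L-1\}$ satisfy $$\prod_{i=1}^d\#A_i=L,\qquad \#A_i,\#A_j\geq2\ \text{ for some }i\neq j,$$ and let $\mathcal S^\infty\subset\mathbb R^d$ be the associated rational product Cantor set. Assume that every coordinate mask polynomial $A_i(X)=\sum_{a\in A_i}X^a$ has no zero on the unit circle $\{|z|=1\}$. Put $$D:=\sum_{i=1}^d\log_L\frac{\#A_i}{\mu_{A_i}},\qquad \mu_{A_i}:=\min_{|z|=1}|A_i(z)|>0.$$ Then, for every $u>0$, there is a constant $C$ depending only on $A_1,\dots,A_d,d,u$ such that for all integers $N\geq1$ $$\operatorname{Fav}\big(\mathcal N_{L^{-N}}(\mathcal S^\infty)\big)\leq C\,N^{-1/(2D+1)+u}.$$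
   Context: For $\theta\in\mathbb S^{d-1}$ let $\pi_\theta(x)=x\cdot\theta$; with $\sigma^{d-1}$ the normalized surface measure on $\mathbb S^{d-1}$, $\operatorname{Fav}(E)=\int_{\mathbb S^{d-1}}\mathcal H^1(\pi_\theta(E))\,d\sigma^{d-1}(\theta)$. $\mathcal N_\delta(E)$ is the open $\delta$-neighbourhood of $E$. The rational product Cantor set is $\mathcal S^\infty=\{\sum_{k\geq1}L^{-k}\alpha_k:\alpha_k\in A_1\times\cdots\times A_d\}$. *)

(* Defs.v *)
From HB Require Import structures.
From mathcomp Require Import all_boot all_order all_algebra.
From mathcomp Require Import all_classical all_reals all_analysis.
From mathcomp Require Import measurable_realfun complex.

Set Implicit Arguments.
Unset Strict Implicit.
Unset Printing Implicit Defensive.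

Import Order.TTheory GRing.Theory Num.Theory.
Import numFieldNormedType.Exports.

Local Open Scope classical_set_scope.
Local Open Scope ring_scope.

(* Points of R^d are row vectors.  Measurable sets of 'rV[T]_n form the product
   sigma-algebra, as for the library's n.-tuple T.  The library's topology on
   'rV[R]_d is the usual one, but its norm is the sup norm; [enorm] is the
   Euclidean norm. *)

Section rV_measurable.
Context {disp : measure_display} {T : sigmaRingType disp} (n : nat).

Let coords : 'I_n -> 'rV[T]_n -> T := fun i x => x ord0 i.

Let rV_set0 : g_sigma_preimage coords set0.
Proof. exact: sigma_algebra0. Qed.

Let rV_setC A : g_sigma_preimage coords A -> g_sigma_preimage coords (~` A).
Proof. exact: sigma_algebraC. Qed.

Let rV_bigcup (F : (set 'rV[T]_n)^nat) :
  (forall i, g_sigma_preimage coords (F i)) ->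
  g_sigma_preimage coords (\bigcup_i (F i)).
Proof. exact: sigma_algebra_bigcup. Qed.

HB.instance Definition _ := @isMeasurable.Build (measure_tuple_display disp)
  'rV[T]_n (g_sigma_preimage coords) rV_set0 rV_setC rV_bigcup.

Lemma measurable_coord (i : 'I_n) :
  measurable_fun [set: 'rV[T]_n] (fun x => x ord0 i).
Proof.
move=> _ Y mY; rewrite setTI; apply: sub_sigma_algebra => /=.
rewrite -bigcup_seq/=; exists i => /=; first by rewrite mem_index_enum.
by exists Y => //; rewrite setTI.
Qed.

End rV_measurable.

Lemma measurable_fun_rVP d1 d2 (T1 : measurableType d1) (T2 : measurableType d2)
    n (f : T1 -> 'rV[T2]_n) :
  (forall i, measurable_fun [set: T1] (fun x => f x ord0 i)) ->
  measurable_fun [set: T1] f.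
Proof.
move=> mf.
have sub : \big[setU/set0]_(i < n) preimage_set_system [set: 'rV[T2]_n]
    (fun x => x ord0 i) measurable `<=` [set B | measurable (f @^-1` B)].
  rewrite -bigcup_seq; apply: bigcup_sub => i _ _ [B mB <-] /=.
  by rewrite setTI -comp_preimage -[X in measurable X]setTI; exact: mf.
move=> _ B mB; rewrite setTI.
suff : <<s \big[setU/set0]_(i < n) preimage_set_system [set: 'rV[T2]_n]
    (fun x => x ord0 i) measurable >> `<=` [set B | measurable (f @^-1` B)].
  by apply; exact: mB.
apply: smallest_sub => //; split => /=.
- by rewrite preimage_set0.
- by move=> A mA; rewrite setTD preimage_setC; exact: measurableC.
- by move=> F mF; rewrite preimage_bigcup; exact: bigcup_measurable.
Qed.

Section lebesgue_rV.
Context {R : realType}.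

(* Lebesgue measure on R^n is built by iterating products of the library's
   Lebesgue measure on R, transported along R * R^n ~ R^(n+1). *)

Definition rV_cons n (p : R * 'rV[R]_n) : 'rV[R]_n.+1 :=
  row_mx (const_mx p.1 : 'rV[R]_1) p.2.

Lemma measurable_rV_cons n : measurable_fun [set: R * 'rV[R]_n] (@rV_cons n).
Proof.
apply: measurable_fun_rVP => i.
case: (unliftP ord0 i) => [j|] ->.
  rewrite (_ : (fun x => _) = (fun v : 'rV[R]_n => v ord0 j) \o snd).
    by apply: measurableT_comp => //; exact: measurable_coord.
  apply/funext => -[a v] /=; rewrite /rV_cons.
  have -> : lift ord0 j = rshift 1 j :> 'I_(1 + n) by apply/val_inj.
  exact: (row_mxEr (const_mx a : 'rV_1) v ord0 j).
rewrite (_ : (fun x => _) = fst)//; apply/funext => -[a v] /=; rewrite /rV_cons.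
have -> : ord0 = lshift n (ord0 : 'I_1) :> 'I_(1 + n) by apply/val_inj.
by rewrite (row_mxEl (const_mx a : 'rV_1)) mxE.
Qed.

Section step.
Variables (n : nat) (mu : {sigma_finite_measure set 'rV[R]_n -> \bar R}).

Definition lebesgue_rVS : set 'rV[R]_n.+1 -> \bar R :=
  pushforward (@lebesgue_measure R \x mu)%E (@rV_cons n).

Let mcons A : measurable A -> measurable (@rV_cons n @^-1` A).
Proof. by move=> mA; rewrite -[X in measurable X]setTI; exact: measurable_rV_cons. Qed.

Let lebesgue_rVS0 : lebesgue_rVS set0 = 0%E.
Proof. by rewrite /lebesgue_rVS /pushforward preimage_set0 measure0. Qed.

Let lebesgue_rVS_ge0 A : (0 <= lebesgue_rVS A)%E.
Proof. by rewrite /lebesgue_rVS /pushforward measure_ge0. Qed.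

Let lebesgue_rVS_sigma_additive : semi_sigma_additive lebesgue_rVS.
Proof.
move=> F mF tF mUF; rewrite /lebesgue_rVS /pushforward preimage_bigcup.
apply: measure_semi_sigma_additive.
- by move=> k; exact: mcons.
- apply/trivIsetP => /= i j _ _ ij; rewrite -preimage_setI.
  by move/trivIsetP : tF => /(_ _ _ _ _ ij) ->//; rewrite preimage_set0.
- by rewrite -preimage_bigcup; exact: mcons.
Qed.

HB.instance Definition _ := isMeasure.Build _ _ _ lebesgue_rVS
  lebesgue_rVS0 lebesgue_rVS_ge0 lebesgue_rVS_sigma_additive.

Let lebesgue_rVS_sigma_finite : sigma_finite [set: 'rV[R]_n.+1] lebesgue_rVS.
Proof.
have /sigma_finiteP[F [FT ndF Ffin]] := sigma_finiteT (@lebesgue_measure R).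
have /sigma_finiteP[G [GT ndG Gfin]] := sigma_finiteT mu.
pose g (x : 'rV[R]_(1 + n)) : R * 'rV[R]_n := (lsubmx x ord0 ord0, rsubmx x).
have mg : measurable_fun [set: 'rV[R]_n.+1] g.
  apply: measurable_fun_pair.
    rewrite (_ : (fun x => _) = fun x : 'rV[R]_(1 + n) => x ord0 (lshift n ord0)).
      exact: measurable_coord.
    by apply/funext => x; rewrite mxE.
  apply: measurable_fun_rVP => i.
  rewrite (_ : (fun x => _) = fun x : 'rV[R]_(1 + n) => x ord0 (rshift 1 i)).
    exact: measurable_coord.
  by apply/funext => x; rewrite mxE.
have gK p : g (rV_cons p) = p.
  case: p => a v; rewrite /g /rV_cons; congr pair.
    by rewrite row_mxKl mxE.
  by rewrite row_mxKr.
exists (fun k => g @^-1` (F k `*` G k)) => [|k].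
  apply/esym; rewrite -subTset => x _.
  have [k _ Fk] : (\bigcup_k F k) (g x).1 by rewrite -FT.
  have [m _ Gm] : (\bigcup_k G k) (g x).2 by rewrite -GT.
  exists (maxn k m) => //; split => /=.
    by move: Fk; exact/subsetPset/ndF/leq_maxl.
  by move: Gm; exact/subsetPset/ndG/leq_maxr.
have [mF Foo] := Ffin k; have [mG Goo] := Gfin k.
have mFG : measurable (F k `*` G k) by exact: measurableX.
split; first by rewrite -[X in measurable X]setTI; exact: mg.
rewrite /lebesgue_rVS /pushforward (_ : _ @^-1` _ = F k `*` G k).
  by rewrite product_measure1E// lte_mul_pinfty// ge0_fin_numE.
by rewrite -comp_preimage (_ : g \o _ = id)//; exact/funext.
Qed.

HB.instance Definition _ := Measure_isSigmaFinite.Build _ _ _ lebesgue_rVS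
  lebesgue_rVS_sigma_finite.

End step.

Fixpoint lebesgue_rV n : {sigma_finite_measure set 'rV[R]_n -> \bar R} :=
  if n is m.+1 then lebesgue_rVS (lebesgue_rV m) else dirac (0 : 'rV[R]_0).

End lebesgue_rV.

Section euclidean.
Context {R : realType} {d : nat}.
Implicit Types (x y : 'rV[R]_d) (E : set 'rV[R]_d).

Definition dotp x y : R := \sum_(i < d) x ord0 i * y ord0 i.

Definition enorm x : R := Num.sqrt (dotp x x).

Definition sphere : set 'rV[R]_d := [set x | enorm x = 1].

Definition thickening (delta : R) E : set 'rV[R]_d :=
  [set x | exists2 y, E y & enorm (x - y) < delta].

Definition unit_ball : set 'rV[R]_d := [set x | enorm x <= 1].

Definition direction x : 'rV[R]_d := (enorm x)^-1 *: x.

Lemma measurable_enorm : measurable_fun [set: 'rV[R]_d] enorm.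
Proof.
apply: (@measurableT_comp _ _ _ _ _ _ (@Num.sqrt R)) => //=.
  by apply: continuous_measurable_fun; exact: sqrt_continuous.
apply: (@measurable_sum _ _ R _ _ _ (fun i x => x ord0 i * x ord0 i)) => i.
by apply: measurable_funM; exact: measurable_coord.
Qed.

Lemma measurable_unit_ball : measurable unit_ball.
Proof.
rewrite (_ : unit_ball = enorm @^-1` [set` `]-oo, 1]]).
  by rewrite -[X in measurable X]setTI; exact: measurable_enorm.
by apply/seteqP; split => x /=; rewrite in_itv.
Qed.

Lemma measurable_direction : measurable_fun [set: 'rV[R]_d] direction.
Proof.
apply: measurable_fun_rVP => i.
rewrite (_ : (fun x => _) = fun x => enorm x `^ (-1) * x ord0 i).
  apply: measurable_funM; last exact: measurable_coord.
  by apply: (measurableT_comp (measurable_powR _)); exact: measurable_enorm.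
by apply/funext => x; rewrite mxE powR_inv1// sqrtr_ge0.
Qed.

HB.instance Definition _ :=
  isMeasurableFun.Build _ _ _ _ direction measurable_direction.

(* The default value of [mnormalize] is not used: the ball has positive finite
   Lebesgue measure. *)
Definition uniform_ball : probability 'rV[R]_d R :=
  mnormalize (mrestr (@lebesgue_rV R d) measurable_unit_ball)
             (dirac (0 : 'rV[R]_d)).

(* Normalized surface measure of the unit sphere, seen as a measure on R^d
   carried by [sphere].  The surface measure of B `<=` sphere is d times the
   Lebesgue measure of the cone {r b : b in B, 0 < r <= 1}, so the normalized
   measure is |{x in unit_ball : x / |x| in B}| / |unit_ball|. *)
Definition sphere_measure : probability 'rV[R]_d R :=
  distribution uniform_ball direction.

End euclidean.

Section hausdorff.
Context {R : realType}.
Implicit Types E U : set R.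

(* 0 is added to the set so that the diameter of set0 is 0 rather than -oo. *)
Definition diam U : \bar R :=
  ereal_sup ([set 0%E] `|` [set `|p.1 - p.2|%:E | p in U `*` U]).

Definition hausdorff1_pre (delta : R) E : \bar R :=
  ereal_inf [set (\sum_(0 <= k <oo) diam (U k))%E | U in
    [set U : (set R)^nat |
      (forall k, (diam (U k) <= delta%:E)%E) /\ E `<=` \bigcup_k U k]].

(* One-dimensional Hausdorff measure H^1 of a subset of the line. *)
Definition hausdorff1 E : \bar R :=
  ereal_sup [set hausdorff1_pre delta E | delta in [set delta : R | 0 < delta]].

End hausdorff.

Definition favard (R : realType) (d : nat) (E : set 'rV[R]_d) : \bar R :=
  (\int[sphere_measure]_(theta in sphere) hausdorff1 (dotp theta @` E))%E.

(* Digits are indexed from 0 rather than from 1. *)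
Definition cantor_product (R : realType) (d L : nat) (A : 'I_d -> {set 'I_L}) :
    set 'rV[R]_d :=
  [set x | exists2 alpha : nat -> 'I_d -> 'I_L,
     (forall k i, alpha k i \in A i) &
     series (fun k => L%:R ^- k.+1 *: \row_i (alpha k i)%:R) @ \oo --> x].

Definition mask_poly (R : realType) (L : nat) (B : {set 'I_L}) : {poly R[i]} :=
  \sum_(a in B) 'X^a.

(* The infimum is a minimum, by compactness of the circle. *)
Definition mask_min (R : realType) (L : nat) (B : {set 'I_L}) : R :=
  inf [set Normc.normc (mask_poly R B).[z] | z in [set z : R[i] | Normc.normc z = 1]].

Definition log_base (R : realType) (b x : R) : R := ln x / ln b.

Definition mask_exponent (R : realType) (d L : nat) (A : 'I_d -> {set 'I_L}) : R :=
  \sum_(i < d) log_base L%:R (#|A i|%:R / mask_min R (A i)).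

Arguments cantor_product R {d L} A.
Arguments mask_poly R {L} B.
Arguments mask_min R {L} B.
Arguments mask_exponent R {d L} A.

(* Main.v *)
Require Import Defs.
From HB Require Import structures.
From mathcomp Require Import all_boot all_order all_algebra.
From mathcomp Require Import all_classical all_reals all_analysis.
From mathcomp Require Import measurable_realfun complex.
From mathcomp Require Import ring lra zify.

Set Implicit Arguments.
Unset Strict Implicit.
Unset Printing Implicit Defensive.

Import Order.TTheory GRing.Theory Num.Theory.
Import numFieldNormedType.Exports.

Local Open Scope classical_set_scope.
Local Open Scope ring_scope.

(* Write a unit direction as theta.  Projecting the Cantor set along theta gives
   the numbers sum_k L^-k a_k with digits a_k in a family t of L reals, and
   independence of the coordinates gives
     |sum_(a in t) e(xi a)| = prod_i |A_i(e(xi theta_i))| >= prod_i mu_(A_i)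
   for every frequency xi.  This is the only information on theta that is used,
   so the bound is uniform in theta.

   Let E_n be the average number of level-n points in the L^-n-cell of a level-n
   point.  Up to constants E_N bounds the L^2 mass of the Fourier transform of
   the level-N measure on [0, L^N].  In the band [L^(n-m), L^n) the transform is
   at least L^(-m D) times that of the level-(n-m) measure, and the latter has
   mass about L^m there as long as E_(n-m) is small compared with L^m.  Adding up
   the N/m disjoint bands shows that E_n <= c L^m cannot hold for all n <= N once
   N >= C m L^(2 m D).

   On the other hand, stop every point whose cell contains K = c' L^m points.  If
   the stopped points have relative mass beta <= c''/K, then E_n <= 2 K for all
   n <= N.  Hence beta >= c''/K.  Stopped points are covered K at a time, and
   L^(m + o(m)) successive blocks of N levels stop all points but a fraction
   L^-m: at level L^((2 D + 1) m + o(m)) the projection has measure O(L^-m). *)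

(** * Trigonometric sums *)

Section trigonometric_sums.
Context {R : realType}.
Implicit Types (x y u : R) (s : seq R).

Lemma sum_const_seq (T : Type) (s : seq T) (c : R) :
  \sum_(x <- s) c = (size s)%:R * c.
Proof. by rewrite big_const_seq count_predT iter_addr_0 mulr_natl. Qed.

Lemma sin_mvt x : 0 < x -> exists2 c, c \in `]0, x[ & sin x = cos c * x.
Proof.
move=> x0; have [|c cx] := @MVT R sin cos 0 x x0.
  by apply: continuous_subspaceT => y; exact: continuous_sin.
by rewrite sin0 !subr0 => ->; exists c.
Qed.

Lemma sin_sqr_le x : sin x ^+ 2 <= x ^+ 2.
Proof.
wlog x0 : x / 0 < x.
  move=> H; have [/H//|x0|<-] := ltgtP 0 x; last by rewrite sin0.
  by have := H (- x); rewrite oppr_gt0 sinN !sqrrN; exact.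
have [c _ ->] := sin_mvt x0.
rewrite exprMn ler_piMl ?sqr_ge0// -real_normK ?num_real//.
Qed.

Lemma cos_ge_quadratic x : 1 - x ^+ 2 / 2 <= cos x.
Proof.
have := sin_sqr_le (x / 2).
have -> : cos x = 1 - 2 * sin (x / 2) ^+ 2.
  have {1}-> : x = (x / 2) *+ 2 by field.
  by rewrite cos_mulr2n cos2sin2; ring.
have -> : (x / 2) ^+ 2 = x ^+ 2 / 4 by field.
lra.
Qed.

Lemma sin_sqr_ge x : `|x| <= 1 / 2 -> x ^+ 2 / 4 <= sin x ^+ 2.
Proof.
wlog x0 : x / 0 < x.
  move=> H; have [/H//|x0|<-] := ltgtP 0 x; last by rewrite expr0n mul0r sin0 expr0n.
  by have := H (- x); rewrite oppr_gt0 sinN !sqrrN normrN; exact.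
rewrite gtr0_norm// => x2.
have [c] := sin_mvt x0; rewrite in_itv/= => /andP[c0 cx] ->.
have := cos_ge_quadratic c => hc.
have c2 : c ^+ 2 <= 1 by rewrite expr_le1//; lra.
have : 1 / 2 <= cos c by lra.
move=> h; rewrite exprMn mulrC; apply: ler_pM; rewrite ?invr_ge0 ?sqr_ge0//.
have -> : 4^-1 = (1 / 2) ^+ 2 :> R by field.
by rewrite ler_sqr ?nnegrE//; lra.
Qed.

(** The square modulus of the sum of e^(i u x) over x in [s], kept real by expanding it as a double
    sum. *)
Definition cos_energy s u : R := \sum_(x <- s) \sum_(y <- s) cos (u * (x - y)).

Lemma cos_energyE s u :
  cos_energy s u = (\sum_(x <- s) cos (u * x)) ^+ 2 + (\sum_(x <- s) sin (u * x)) ^+ 2.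
Proof.
rewrite !expr2 !mulr_suml -big_split/=; apply: eq_bigr => x _.
rewrite !mulr_sumr -big_split/=; apply: eq_bigr => y _.
by rewrite mulrBr cosB.
Qed.

Lemma cos_energy_ge0 s u : 0 <= cos_energy s u.
Proof. by rewrite cos_energyE addr_ge0 ?sqr_ge0. Qed.

Lemma cos_energy_le s u : cos_energy s u <= (size s)%:R ^+ 2.
Proof.
have -> : (size s)%:R ^+ 2 = \sum_(x <- s) \sum_(y <- s) (1 : R).
  by rewrite !sum_const_seq mulr1 expr2.
by apply: ler_sum => x _; apply: ler_sum => y _; exact: cos_le1.
Qed.

Lemma cos_energy0 s : cos_energy s 0 = (size s)%:R ^+ 2.
Proof.
rewrite cos_energyE; under eq_bigr do rewrite mul0r cos0.
under [in X in _ + X]eq_bigr do rewrite mul0r sin0.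
by rewrite [X in _ + X ^+ 2]big1// expr0n addr0 sum_const_seq mulr1.
Qed.

Lemma cos_energyN s u : cos_energy s (- u) = cos_energy s u.
Proof.
by apply: eq_bigr => x _; apply: eq_bigr => y _; rewrite mulNr cosN.
Qed.

Lemma cos_energy_near0 s u (r : R) : {in s &, forall x y, `|x - y| <= r} ->
  (1 - (u * r) ^+ 2 / 2) * (size s)%:R ^+ 2 <= cos_energy s u.
Proof.
move=> sr.
have -> : (1 - (u * r) ^+ 2 / 2) * (size s)%:R ^+ 2 =
    \sum_(x <- s) \sum_(y <- s) (1 - (u * r) ^+ 2 / 2).
  by rewrite !sum_const_seq; ring.
rewrite /cos_energy !big_seq; apply: ler_sum => x xs.
rewrite !big_seq; apply: ler_sum => y ys.
apply: le_trans (cos_ge_quadratic _); rewrite lerB// ler_pM2r ?invr_gt0//.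
rewrite !exprMn ler_wpM2l ?sqr_ge0// -(real_normK (num_real (x - y))).
by rewrite ler_sqr ?nnegrE// ?sr// (le_trans _ (sr _ _ xs ys)).
Qed.

(* [sin s] is odd, so the cross terms cancel *)
Lemma cos_energyM s1 s2 s (a u : R) :
  (forall F : R -> R, \sum_(z <- s) F z = \sum_(x <- s1) \sum_(y <- s2) F (x + a * y)) ->
  cos_energy s u = cos_energy s1 u * cos_energy s2 (u * a).
Proof.
move=> sE; rewrite !cos_energyE !sE.
under eq_bigr do under eq_bigr do rewrite mulrDr cosD mulrA.
under [in X in _ + X ^+ 2]eq_bigr do under eq_bigr do rewrite mulrDr sinD mulrA.
under eq_bigr do rewrite sumrB -!mulr_sumr.
under [in X in _ + X ^+ 2]eq_bigr do rewrite big_split -!mulr_sumr/=.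
rewrite sumrB big_split/= -!mulr_suml; ring.
Qed.

(** The Fejér kernel without its usual factor 1/H: the square modulus of the sum of e^(i j u) over 0
    <= j < H. *)
Definition fejer (H : nat) u : R := cos_energy [seq j%:R | j <- iota 0 H] u.

Lemma fejer_le H u : fejer H u <= H%:R ^+ 2.
Proof. by rewrite (le_trans (cos_energy_le _ _))// size_map size_iota. Qed.

Lemma dirichlet_cos H u : 2 * sin (u / 2) * \sum_(j <- iota 0 H) cos (u * j%:R) =
  sin (H%:R * u - u / 2) + sin (u / 2).
Proof.
elim: H => [|H IH].
  by rewrite big_nil mul0r sub0r sinN mulr0 addNr.
rewrite -[H.+1]addn1 iotaD add0n big_cat big_seq1 mulrDr IH.
have -> : (H + 1)%:R * u - u / 2 = u * H%:R + u / 2 :> R by rewrite natrD; field.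
have -> : H%:R * u - u / 2 = u * H%:R - u / 2 by ring.
rewrite !sinD sinN cosN; ring.
Qed.

Lemma dirichlet_sin H u : 2 * sin (u / 2) * \sum_(j <- iota 0 H) sin (u * j%:R) =
  cos (u / 2) - cos (H%:R * u - u / 2).
Proof.
elim: H => [|H IH].
  by rewrite big_nil mul0r sub0r cosN mulr0 subrr.
rewrite -[H.+1]addn1 iotaD add0n big_cat big_seq1 mulrDr IH.
have -> : (H + 1)%:R * u - u / 2 = u * H%:R + u / 2 :> R by rewrite natrD; field.
have -> : H%:R * u - u / 2 = u * H%:R - u / 2 by ring.
rewrite !cosD sinN cosN; ring.
Qed.

(** The closed form gives 4 sin(u/2)^2 [fejer H u] = 2 - 2 cos(H u) <= 4, and sin(u/2)^2 >= u^2/16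
    for |u| <= 1. *)
Lemma fejer_decay H u : `|u| <= 1 -> fejer H u * u ^+ 2 <= 16.
Proof.
move=> u1.
have h1 : (u / 2) ^+ 2 / 4 <= sin (u / 2) ^+ 2.
  by apply: sin_sqr_ge; rewrite normrM [`|2^-1|]gtr0_norm ?invr_gt0//; lra.
have h2 : 4 * (fejer H u * sin (u / 2) ^+ 2) <= 4.
  have -> : 4 * (fejer H u * sin (u / 2) ^+ 2) =
      (2 * sin (u / 2) * \sum_(j <- iota 0 H) cos (u * j%:R)) ^+ 2 +
      (2 * sin (u / 2) * \sum_(j <- iota 0 H) sin (u * j%:R)) ^+ 2.
    by rewrite /fejer cos_energyE !big_map; ring.
  rewrite dirichlet_cos dirichlet_sin; set p := _ - u / 2; set q := u / 2.
  have -> : (sin p + sin q) ^+ 2 + (cos q - cos p) ^+ 2 =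
      (cos p ^+ 2 + sin p ^+ 2) + (cos q ^+ 2 + sin q ^+ 2) - 2 * cos (p + q).
    by rewrite (cosD p q); ring.
  rewrite !cos2Dsin2; have := cos_geN1 (p + q); lra.
have F0 := cos_energy_ge0 [seq j%:R | j <- iota 0 H] u.
have h3 : fejer H u * ((u / 2) ^+ 2 / 4) <= fejer H u * sin (u / 2) ^+ 2.
  exact: ler_wpM2l.
have -> : fejer H u * u ^+ 2 = 16 * (fejer H u * ((u / 2) ^+ 2 / 4)) by field.
lra.
Qed.

End trigonometric_sums.

Section digit_points.
Context {R : realType}.

Lemma ler_sum_sub (T : eqType) (s1 s2 : seq T) (F : T -> R) :
  uniq s1 -> {subset s1 <= s2} -> (forall x, 0 <= F x) ->
  \sum_(x <- s1) F x <= \sum_(x <- s2) F x.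
Proof.
move=> + + F0; elim: s1 s2 => [|x s1 IH] s2 /=.
  by move=> _ _; rewrite big_nil sumr_ge0.
move=> /andP[xs1 us1] s12.
have xs2 : x \in s2 by rewrite s12 ?mem_head.
rewrite big_cons (perm_big _ (perm_to_rem xs2)) big_cons lerD2l IH// => y ys1.
have := s12 y; rewrite inE ys1 orbT => /(_ isT).
rewrite (perm_mem (perm_to_rem xs2)) inE => /predU1P[yx|//].
by move: xs1; rewrite -yx ys1.
Qed.

Lemma sum_indicator_uniq (T : eqType) (s : seq T) (i : T) :
  uniq s -> i \in s -> \sum_(v <- s) (i == v)%:R = 1 :> R.
Proof.
move=> us si; rewrite (perm_big _ (perm_to_rem si)) big_cons eqxx.
rewrite big1_seq; first by rewrite /= addr0.
move=> v /=; rewrite rem_filter// mem_filter/=.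
by case/andP => /negPf vi _; rewrite eq_sym vi.
Qed.

(* Expand [0 <= \sum_v (#{x | f x = v} - #{x | g x = v})^2]. *)
Lemma collisions_le (T : Type) (V : eqType) (s : seq T) (f g : T -> V) :
  \sum_(x <- s) \sum_(y <- s) (f x == g y)%:R *+ 2 <=
  \sum_(x <- s) \sum_(y <- s) (f x == f y)%:R +
  \sum_(x <- s) \sum_(y <- s) (g x == g y)%:R :> R.
Proof.
pose D := undup (map f s ++ map g s).
pose N (h : T -> V) v : R := \sum_(x <- s) (h x == v)%:R.
have NE (h k : T -> V) : {subset map h s <= D} ->
    \sum_(x <- s) \sum_(y <- s) (h x == k y)%:R = \sum_(v <- D) N h v * N k v.
  move=> hD; rewrite /N; under [RHS]eq_bigr do rewrite mulr_suml.
  rewrite [RHS]exchange_big/=.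
  have -> : \sum_(x <- s) \sum_(y <- s) (h x == k y)%:R =
      \sum_(w <- map h s) \sum_(y <- s) (w == k y)%:R :> R by rewrite big_map.
  have -> : \sum_(j <- s) \sum_(i <- D) (h j == i)%:R * (\sum_(x <- s) (k x == i)%:R) =
      \sum_(w <- map h s) \sum_(i <- D) (w == i)%:R * (\sum_(x <- s) (k x == i)%:R) :> R.
    by rewrite big_map.
  apply: eq_big_seq => w ws.
  rewrite [RHS](eq_bigr (fun i => (w == i)%:R * (\sum_(x <- s) (k x == w)%:R))).
    rewrite -mulr_suml sum_indicator_uniq ?undup_uniq ?hD// mul1r.
    by apply: eq_bigr => y _; rewrite eq_sym.
  by move=> i _; have [->//|_] := eqVneq w i; rewrite !mul0r.
have fD : {subset map f s <= D}.
  by move=> v vs; rewrite mem_undup mem_cat vs.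
have gD : {subset map g s <= D}.
  by move=> v vs; rewrite mem_undup mem_cat vs orbT.
have -> : \sum_(x <- s) \sum_(y <- s) (f x == g y)%:R *+ 2 =
    \sum_(v <- D) (N f v * N g v) *+ 2 :> R.
  by rewrite [RHS]sumrMnl -NE// -sumrMnl; apply: eq_bigr => x _; rewrite sumrMnl.
rewrite !NE// -big_split/=; apply: ler_sum => v _.
have := sqr_ge0 (N f v - N g v); rewrite sqrrB -!expr2; lra.
Qed.

End digit_points.

(** * Sums over integer frequencies and the Fejér kernel *)

Section frequencies.
Context {R : realType}.
Implicit Types (s : seq R) (H : nat).

Let sumH H (F : R -> R) :
  \sum_(x <- [seq j%:R | j <- iota 0 H]) F x = \sum_(j <- iota 0 H) F j%:R.
Proof. exact: big_map. Qed.

(** Both sides are the fourfold sum of cos((j - k)(x - y)). This duality trades energy at integer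
    frequencies for a kernel that localizes pairs of points. *)
Lemma sum_fejer s H :
  \sum_(x <- s) \sum_(y <- s) fejer H (x - y) =
  \sum_(j <- iota 0 H) \sum_(k <- iota 0 H) cos_energy s (j%:R - k%:R).
Proof.
rewrite /fejer /cos_energy; under eq_bigr do under eq_bigr do
  (rewrite sumH; under eq_bigr do rewrite sumH).
under eq_bigr do rewrite exchange_big/=.
rewrite exchange_big/=; apply: eq_bigr => j _.
under eq_bigr do rewrite exchange_big/=.
rewrite exchange_big/=; apply: eq_bigr => k _.
by apply: eq_bigr => x _; apply: eq_bigr => y _; rewrite mulrC.
Qed.

Lemma cos_energy_distn s (i j : nat) :
  cos_energy s (i%:R - j%:R) = cos_energy s (if (i <= j)%N then j - i else i - j)%N%:R.
Proof.
case: leqP => [ij|/ltnW ij]; rewrite natrB//.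
by rewrite -cos_energyN opprB.
Qed.

Lemma fejer_diagonal_le s H :
  (size s)%:R * H%:R ^+ 2 <= \sum_(x <- s) \sum_(y <- s) fejer H (x - y).
Proof.
rewrite -sum_const_seq big_seq [leRHS]big_seq; apply: ler_sum => x xs.
have := @ler_sum_sub R R [:: x] s (fun y => fejer H (x - y)).
rewrite big_seq1 subrr /fejer cos_energy0 size_map size_iota; apply => //.
  by move=> y; rewrite inE => /eqP ->.
by move=> y; exact: cos_energy_ge0.
Qed.

(** The diagonal bounds the dual sum from below by (size s) H^2. From above, each of the H rows j -
    k with one index fixed meets every frequency below H at most twice, once per sign. *)
Lemma sum_cos_energy_ge s H :
  (size s)%:R * H%:R <= 2 * \sum_(k <- iota 0 H) cos_energy s k%:R.
Proof.
have [->|H0] := posnP H.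
  by rewrite mulr0 mulr_ge0// sumr_ge0// => k _; exact: cos_energy_ge0.
have HR : 0 < H%:R :> R by rewrite ltr0n.
rewrite -(ler_pM2r HR) -mulrA -expr2.
apply: le_trans (fejer_diagonal_le s H) _.
rewrite sum_fejer -[leRHS]mulrC -[H in leRHS](size_iota 0 H) -sum_const_seq size_iota.
rewrite big_seq [leRHS]big_seq; apply: ler_sum => i.
rewrite mem_iota add0n => /= iH.
rewrite (bigID (fun j => (i <= j)%N))/= mulr_natl mulr2n; apply: lerD.
  rewrite -big_filter (eq_big_seq (fun j => cos_energy s (j - i)%N%:R)); last first.
    by move=> j; rewrite mem_filter cos_energy_distn => /andP[->].
  rewrite -(big_map (fun j => (j - i)%N) xpredT (fun k => cos_energy s k%:R)).
  apply: ler_sum_sub => [||k]; last exact: cos_energy_ge0.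
    rewrite map_inj_in_uniq ?filter_uniq ?iota_uniq// => j k.
    rewrite !mem_filter => /andP[ij _] /andP[ik _] e.
    by rewrite -(subnK ij) e subnK.
  move=> _ /mapP[j + ->]; rewrite mem_filter !mem_iota !add0n => /andP[_ /= jH].
  by rewrite /= (leq_ltn_trans (leq_subr _ _)).
rewrite -big_filter (eq_big_seq (fun j => cos_energy s (i - j)%N%:R)); last first.
  by move=> j; rewrite mem_filter cos_energy_distn => /andP[/negPf->].
rewrite -(big_map (fun j => (i - j)%N) xpredT (fun k => cos_energy s k%:R)).
apply: ler_sum_sub => [||k]; last exact: cos_energy_ge0.
  rewrite map_inj_in_uniq ?filter_uniq ?iota_uniq// => j k.
  rewrite !mem_filter -!ltnNge => /andP[ij _] /andP[ik _] e.
  by rewrite -(subKn (ltnW ij)) e subKn// ltnW.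
move=> _ /mapP[j + ->]; rewrite mem_filter !mem_iota !add0n => /andP[_ /= jH].
by rewrite /= (leq_ltn_trans (leq_subr _ _)).
Qed.

(** With length 2 H, every row i < 2 H of differences i - j contains each frequency k < H up to
    sign: take j = i + k if i < H and j = i - k otherwise. *)
Lemma sum_cos_energy_le s H :
  (2 * H)%:R * (\sum_(k <- iota 0 H) cos_energy s k%:R) <=
  \sum_(x <- s) \sum_(y <- s) fejer (2 * H) (x - y).
Proof.
rewrite sum_fejer -[X in X%:R * _ <= _](size_iota 0) -sum_const_seq.
rewrite big_seq [leRHS]big_seq; apply: ler_sum => i.
rewrite mem_iota add0n => /= iH; have [iltH|Hi] := ltnP i H.
  have -> : \sum_(k <- iota 0 H) cos_energy s k%:R =
      \sum_(j <- [seq (i + k)%N | k <- iota 0 H]) cos_energy s (i%:R - j%:R).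
    rewrite big_map; apply: eq_bigr => k _; rewrite natrD -cos_energyN.
    by congr cos_energy; ring.
  apply: ler_sum_sub => [||k]; last exact: cos_energy_ge0.
    by rewrite map_inj_uniq ?iota_uniq//; exact: addnI.
  move=> _ /mapP[j + ->]; rewrite !mem_iota !add0n => /andP[_ /= jH].
  by rewrite /= mul2n -addnn -addSn leq_add// ltnW.
have -> : \sum_(k <- iota 0 H) cos_energy s k%:R =
    \sum_(j <- [seq (i - k)%N | k <- iota 0 H]) cos_energy s (i%:R - j%:R).
  rewrite big_map; apply: eq_big_seq => k; rewrite mem_iota add0n => /= kH.
  by rewrite natrB ?(leq_trans (ltnW kH))//; congr cos_energy; ring.
apply: ler_sum_sub => [||k]; last exact: cos_energy_ge0.
  rewrite map_inj_in_uniq ?iota_uniq// => j k; rewrite !mem_iota !add0n.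
  move=> /andP[_ jH] /andP[_ kH] e.
  have ji : (j <= i)%N by rewrite (leq_trans (ltnW jH)).
  have ki : (k <= i)%N by rewrite (leq_trans (ltnW kH)).
  by rewrite -(subKn ji) e subKn.
move=> _ /mapP[j + ->]; rewrite !mem_iota !add0n => /andP[_ /= jH].
by rewrite /= (leq_ltn_trans (leq_subr _ _)).
Qed.

End frequencies.

(** * Points with given digits, cells and energy *)

Section cells.
Context {R : realType}.

Lemma floor_distn_lt (x y : R) : `|(Num.floor x - Num.floor y)%:~R| < `|x - y| + 1.
Proof.
have /andP[x1 x2] := floor_itv x; have /andP[y1 y2] := floor_itv y.
move: x2 y2; rewrite !intrD !intrN => x2 y2.
rewrite ltr_norml; have := ler_norm (x - y); have := ler_norm (y - x).
rewrite distrC; lra.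
Qed.

Lemma floor_eq_near (x y : R) (k : int) : `|x - y| < k%:~R ->
  (`|Num.floor x - Num.floor y| <= k)%R.
Proof.
move=> xy; rewrite -ltzD1 -(ltr_int R) intrD.
have := floor_distn_lt x y; rewrite -intr_norm => /lt_trans; apply.
by rewrite ltrD2r.
Qed.

Lemma floor_near_eq (x y : R) : Num.floor x = Num.floor y -> `|x - y| < 1.
Proof.
move=> xy; have /andP[x1 x2] := floor_itv x; have /andP[] := floor_itv y.
rewrite -xy; move: x2; rewrite !intrD => x2 y1 y2.
by rewrite ltr_norml; lra.
Qed.

Lemma floorD_cases (x y : R) :
  (Num.floor (x + y) == Num.floor x + Num.floor y) ||
  (Num.floor (x + y) == Num.floor x + Num.floor y + 1).
Proof.
have /andP[x1 x2] := floor_itv x; have /andP[y1 y2] := floor_itv y.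
have /andP[z1 z2] := floor_itv (x + y).
have : (Num.floor x + Num.floor y)%:~R < (Num.floor (x + y) + 1)%:~R :> R.
  by rewrite intrD; lra.
have : (Num.floor (x + y))%:~R < (Num.floor x + 1 + (Num.floor y + 1))%:~R :> R.
  by rewrite [ltRHS]intrD; lra.
rewrite !ltr_int; lia.
Qed.

End cells.

Section digit_points.
Context {R : realType} (L : nat) (t : seq R).
Implicit Types (n m k N : nat).

(* The points $\sum_{k=1}^n L^{-k} a_k$, [a_k \in t], with multiplicity. *)
Fixpoint points n : seq R :=
  if n is m.+1 then [seq L%:R^-1 * (a + y) | a <- t, y <- points m] else [:: 0].

Definition cell n (x : R) : int := Num.floor (L%:R ^+ n * x).

(** When [t] has L entries, this is L^n times the average E_n of the overview. *)
Definition energy n : R :=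
  \sum_(x <- points n) \sum_(y <- points n) (cell n x == cell n y)%:R.

Lemma big_points n (F : R -> R) : \sum_(z <- points n.+1) F z =
  \sum_(a <- t) \sum_(y <- points n) F (L%:R^-1 * (a + y)).
Proof. by rewrite /= big_allpairs_dep. Qed.

(** Self-similarity: the first n and the last k digits vary independently. Through [cos_energyM]
    this factors the Fourier transform. *)
Lemma big_points_split n k (F : R -> R) : \sum_(z <- points (n + k)) F z =
  \sum_(x <- points n) \sum_(y <- points k) F (x + L%:R ^- n * y).
Proof.
elim: n F => [|n IH] F.
  by rewrite big_seq1; apply: eq_bigr => y _; rewrite add0r expr0 invr1 mul1r.
rewrite addSn !big_points; apply: eq_bigr => a _; rewrite IH.
apply: eq_bigr => x _; apply: eq_bigr => y _; congr F.
by rewrite exprS invfM !mulrDr !addrA mulrA.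
Qed.

Lemma energy_ge0 n : 0 <= energy n.
Proof. by apply: sumr_ge0 => x _; apply: sumr_ge0. Qed.

Hypothesis sizet : size t = L.

Lemma size_points n : size (points n) = (L ^ n)%N.
Proof. by elim: n => [//|n IH]; rewrite /= size_allpairs IH sizet expnS. Qed.

Hypothesis L4 : (4 <= L)%N.

Let L4R : 4 <= L%:R :> R.
Proof. by rewrite ler_nat. Qed.

Lemma exprL_gt0 n : 0 < L%:R ^+ n :> R.
Proof. by rewrite exprn_gt0//; have := L4R; lra. Qed.

Lemma exprL_ge1 n : 1 <= L%:R ^+ n :> R.
Proof. by rewrite exprn_ege1//; have := L4R; lra. Qed.

Hypothesis t4 : {in t, forall a, `|a| <= 1 / 4}.

Lemma points_le n x : x \in points n -> `|x| <= 1 / 4.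
Proof.
elim: n x => [|n IH] x.
  by rewrite inE => /eqP ->; rewrite normr0; lra.
move=> /allpairsP[[a y] /= [/t4 a4 /IH y4 ->]].
have := ler_normD a y; rewrite normrM normfV normr_nat => ay.
by rewrite mulrC ler_pdivrMr; have := L4R; lra.
Qed.

Lemma points_dist n : {in points n &, forall x y, `|x - y| <= 1 / 2}.
Proof.
move=> x y /points_le x4 /points_le y4.
by have := ler_normB x y; lra.
Qed.

(** Translating all cell indices does not change which pairs coincide, so both terms on the right of
    [collisions_le] are the energy. *)
Lemma sum_cell_shift n (l : int) :
  \sum_(x <- points n) \sum_(y <- points n) (cell n x == cell n y + l)%:R <= energy n.
Proof.
have := collisions_le (R := R) (points n) (cell n) (fun y => cell n y + l).
under [in X in _ <= _ + X]eq_bigr do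
  under eq_bigr do rewrite (inj_eq (addIr l)).
rewrite -/(energy n) -mulr2n.
under eq_bigr do rewrite sumrMnl.
by rewrite sumrMnl lerMn2r.
Qed.

(** Decay of the kernel between cells at distance l. It is measured by l - 1 because points of such
    cells may be barely more than l - 1 cell widths apart. *)
Definition fejer_weight (l : nat) : R := if (l <= 1)%N then 1 else l.-1%:R ^- 2.

Lemma fejer_weight_ge0 l : 0 <= fejer_weight l.
Proof. by rewrite /fejer_weight; case: ifP => // _; rewrite invr_ge0 exprn_ge0. Qed.

Lemma sum_fejer_weight M : \sum_(l <- iota 0 M) fejer_weight l <= 4.
Proof.
(* The bound is strengthened so that the induction absorbs 1/(m + 2)^2 <= 1/(m + 1) - 1/(m + 2). *)
have H m : \sum_(l <- iota 0 m.+3) fejer_weight l <= 4 - m.+1%:R^-1.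
  elim: m => [|m IH].
    by rewrite /= !big_cons big_nil /fejer_weight /= expr1n !invr1; lra.
  rewrite -[m.+4]addn1 iotaD big_cat big_seq1/= /fejer_weight/=.
  apply: (le_trans (lerD IH (lexx _))).
  have m1 : 0 < m.+1%:R :> R by rewrite ltr0n.
  have -> : m.+2%:R = m.+1%:R + 1 :> R by rewrite -natr1.
  move: m1; set a := m.+1%:R => a0.
  have a1 : 0 < (a + 1)^-1 by rewrite invr_gt0; lra.
  have h1 : (a + 1) ^- 2 <= a^-1 * (a + 1)^-1.
    by rewrite expr2 invfM ler_pM2r// lef_pV2 ?posrE; lra.
  have h2 : a^-1 * (a + 1)^-1 = a^-1 - (a + 1)^-1.
    by field; rewrite !gt_eqF//; lra.
  by move: h1; rewrite h2; move: (_ ^- 2) (a^-1) (a + 1)^-1 => p q r; lra.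
case: M => [|[|[|m]]].
- by rewrite big_nil.
- by rewrite big_seq1 /fejer_weight/=; lra.
- by rewrite /= !big_cons big_nil /fejer_weight /=; lra.
- apply: (le_trans (H _)); rewrite lerBlDr lerDl invr_ge0//.
Qed.

(** Equal or adjacent cells get the trivial bound (2 L^n)^2, the others [fejer_decay], which applies
    since points are within 1/2 of each other. *)
Lemma fejer_cell n x y : x \in points n -> y \in points n ->
  fejer (2 * L ^ n) (x - y) <=
    16 * (L%:R ^+ n) ^+ 2 * fejer_weight `|cell n x - cell n y|.
Proof.
move=> xn yn; have xy := points_dist xn yn.
rewrite /fejer_weight; case: leqP => [_|].
  rewrite mulr1; apply: le_trans (fejer_le _ _) _.
  rewrite natrM natrX exprMn ler_pM2r; first lra.
  by rewrite exprn_gt0// exprL_gt0.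
set l := `|_|%N => l2.
have l1 : l = l.-1.+1 by case: (l) l2.
have lR : 0 < l.-1%:R :> R by rewrite ltr0n; case: (l) l2 => [|[|]].
have d : l.-1%:R < L%:R ^+ n * `|x - y|.
  have := floor_distn_lt (L%:R ^+ n * x) (L%:R ^+ n * y).
  rewrite -mulrBr normrM [`|_ ^+ _|]gtr0_norm ?exprL_gt0//.
  have -> : `|(Num.floor (L%:R ^+ n * x) - Num.floor (L%:R ^+ n * y))%:~R| = l%:R :> R.
    by rewrite -intr_norm -[l%:R]/(l%:~R) /l abszE.
  by rewrite l1 -natr1 ltrD2r.
have dd : l.-1%:R ^+ 2 <= (L%:R ^+ n) ^+ 2 * (x - y) ^+ 2.
  rewrite -(real_normK (num_real (x - y))) -exprMn ler_sqr ?nnegrE ?ltW//.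
  exact: lt_trans d.
have F := @fejer_decay R (2 * L ^ n) (x - y) ltac:(lra).
rewrite -[leRHS]mulrC ler_pdivlMl ?exprn_gt0//.
apply: le_trans (ler_wpM2r _ dd) _; first exact: cos_energy_ge0.
rewrite -mulrA mulrC [_ * fejer _ _]mulrC ler_pM2r// exprn_gt0// exprL_gt0//.
Qed.

(** Group the pairs by the distance of their cells. Each of the two signs of a shift costs at most
    one energy and the weights sum to at most 4, hence 128 = 16 * 4 * 2. *)
Lemma sum_fejer_le n :
  \sum_(x <- points n) \sum_(y <- points n) fejer (2 * L ^ n) (x - y) <=
  128 * (L%:R ^+ n) ^+ 2 * energy n.
Proof.
pose M := (\max_(x <- points n) \max_(y <- points n) `|cell n x - cell n y|%N).+1.
pose c := 16 * (L%:R ^+ n) ^+ 2 : R.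
have c0 : 0 <= c by rewrite mulr_ge0// sqr_ge0.
have h x y : x \in points n -> y \in points n ->
    fejer (2 * L ^ n) (x - y) <= \sum_(l <- iota 0 M) c * fejer_weight l *
      ((cell n x == cell n y + l%:Z)%:R + (cell n x == cell n y - l%:Z)%:R).
  move=> xn yn; apply: le_trans (fejer_cell xn yn) _; rewrite -/c.
  set l := `|_|%N.
  have lM : (l < M)%N.
    rewrite /M ltnS /l (big_rem x)//= leq_max; apply/orP; left.
    by rewrite (big_rem y)//= leq_max leqnn.
  have E : forall l, 0 <= c * fejer_weight l *
      ((cell n x == cell n y + l%:Z)%:R + (cell n x == cell n y - l%:Z)%:R).
    by move=> k; rewrite mulr_ge0 ?addr_ge0// mulr_ge0// fejer_weight_ge0.
  apply: le_trans; last first.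
    apply: (@ler_sum_sub _ _ [:: l]) => //.
    by move=> k; rewrite inE => /eqP ->; rewrite mem_iota.
  rewrite big_seq1 ler_peMr ?mulr_ge0 ?fejer_weight_ge0//.
  have [e|e] := leP 0 (cell n x - cell n y).
    have -> : cell n x = cell n y + l%:Z by rewrite /l gez0_abs//; ring.
    by rewrite eqxx lerDl.
  have -> : cell n x = cell n y - l%:Z by rewrite /l ltz0_abs//; ring.
  by rewrite eqxx lerDr.
apply: (@le_trans _ _ (\sum_(l <- iota 0 M) c * fejer_weight l * (energy n + energy n))).
  apply: (@le_trans _ _ (\sum_(x <- points n) \sum_(y <- points n)
      \sum_(l <- iota 0 M) c * fejer_weight l *
      ((cell n x == cell n y + l%:Z)%:R + (cell n x == cell n y - l%:Z)%:R))).
    rewrite big_seq [leRHS]big_seq; apply: ler_sum => x xn.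
    by rewrite big_seq [leRHS]big_seq; apply: ler_sum => y yn; exact: h.
  under eq_bigr do rewrite exchange_big/=.
  rewrite exchange_big/=; apply: ler_sum => l _.
  under eq_bigr do rewrite -mulr_sumr.
  rewrite -mulr_sumr ler_wpM2l// ?mulr_ge0 ?fejer_weight_ge0//.
  under eq_bigr do rewrite big_split/=.
  by rewrite big_split/= lerD// sum_cell_shift.
rewrite -mulr_suml -mulr_sumr.
have := sum_fejer_weight M; have := energy_ge0 n => e0 w.
have -> : 128 * (L%:R ^+ n) ^+ 2 * energy n = c * 4 * (energy n + energy n).
  by rewrite /c; ring.
by rewrite ler_wpM2r ?addr_ge0// ler_wpM2l.
Qed.

End digit_points.

(** * The energy grows *)

Section energy_growth.
Context {R : realType} (L : nat) (t : seq R) (kappa : R).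
Context (sizet : size t = L) (L4 : (4 <= L)%N)
  (t4 : {in t, forall a, `|a| <= 1 / 4}).
(** In the application [kappa] is L^(2 D), the worst loss of square modulus per digit. *)
Hypothesis kappa_t : forall xi, L%:R ^+ 2 <= kappa * cos_energy t xi.

Local Notation points := (points L t).
Local Notation energy := (energy L t).
Local Notation l := (L%:R : R).

Let l_gt0 n : 0 < l ^+ n. Proof. exact: exprL_gt0. Qed.

Let l2_gt0 n : 0 < (l ^+ n) ^+ 2. Proof. exact: exprn_gt0. Qed.

(* The square modulus of the Fourier transform of the uniform probability on
   [points n]. *)
Definition power_spectrum n (xi : R) : R :=
  cos_energy (points n) xi / (l ^+ n) ^+ 2.

Local Notation P := power_spectrum.

Lemma power_spectrum_ge0 n xi : 0 <= P n xi.
Proof. by rewrite divr_ge0 ?cos_energy_ge0// ltW. Qed.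

Lemma power_spectrumD n k xi : P (n + k) xi = P n xi * P k (xi * l ^- n).
Proof.
rewrite /P (cos_energyM xi (@big_points_split _ L t n k)) exprD exprMn invfM.
by rewrite mulrACA.
Qed.

Lemma power_spectrum1 xi : l ^+ 2 * P 1 xi = cos_energy t (xi / l).
Proof.
have l2 : l ^+ 2 != 0 by rewrite gt_eqF//; exact: (l2_gt0 1).
rewrite /P expr1 mulrC divfK//.
rewrite /cos_energy big_points; apply: eq_bigr => a _.
rewrite big_seq1 big_points; apply: eq_bigr => b _; rewrite big_seq1 !addr0.
by congr cos; rewrite -mulrBr mulrA.
Qed.

Lemma kappa_ge1 : 1 <= kappa.
Proof.
have := kappa_t 0; rewrite cos_energy0 sizet.
by rewrite -{1}[l ^+ 2]mul1r ler_pM2r//; exact: (l2_gt0 1).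
Qed.

Lemma power_spectrum_ge n xi : 1 <= kappa ^+ n * P n xi.
Proof.
elim: n xi => [|n IH] xi.
  by rewrite /P /cos_energy !big_seq1 subrr mulr0 cos0 !expr0 expr1n divr1 mul1r.
rewrite [kappa ^+ _]exprS -add1n power_spectrumD mulrACA -[leLHS]mulr1 ler_pM//.
rewrite -(ler_pM2l (l2_gt0 1)) expr1 mulr1 mulrCA power_spectrum1.
exact: kappa_t.
Qed.

Lemma power_spectrum_near0 n xi : `|xi| <= 1 -> 1 / 2 <= P n xi.
Proof.
move=> xi1; rewrite /P ler_pdivlMr//.
have := cos_energy_near0 xi (@points_dist _ L t L4 t4 n).
rewrite size_points// natrX; apply: le_trans; rewrite ler_pM2r//.
have xi2 : xi ^+ 2 <= 1 by rewrite -real_normK ?num_real// expr_le1.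
by rewrite exprMn expr_div_n expr1n; lra.
Qed.

Lemma sum_power_spectrum_le n :
  \sum_(0 <= k < L ^ n) P n k%:R <= 64 * (energy n / l ^+ n).
Proof.
rewrite /P -mulr_suml /index_iota subn0.
have := le_trans (sum_cos_energy_le (points n) (L ^ n)) (sum_fejer_le L4 t4 n).
rewrite natrM natrX => h; rewrite ler_pdivrMr//.
have -> : 64 * (energy n / l ^+ n) * (l ^+ n) ^+ 2 = 64 * energy n * l ^+ n.
  by field; rewrite gt_eqF.
rewrite -(ler_pM2l (_ : 0 < 2 * l ^+ n)) ?mulr_gt0//.
by apply: le_trans h _; rewrite le_eqVlt; apply/orP; left; apply/eqP; ring.
Qed.

Lemma sum_power_spectrum_ge n m :
  l ^+ m / 2 <= \sum_(0 <= k < L ^ (n + m)) P n k%:R.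
Proof.
rewrite /P -mulr_suml /index_iota subn0.
have := sum_cos_energy_ge (points n) (L ^ (n + m)).
rewrite size_points// -natrM !natrM !natrX => h; rewrite ler_pdivlMr//.
by move: h; rewrite exprD mulrA; lra.
Qed.

(** At level n, frequencies below L^n carry at most 64 B <= L^m/4 and those below L^(n+m) at least
    L^m/2, so the band carries L^m/4. In passing to level N, the next m digits cost at most kappa^m,
    and the remaining ones a factor 2 by [power_spectrum_near0], as k/L^(n+m) <= 1. *)
Lemma band_ge n m N (B : R) : energy n <= B * l ^+ n -> 256 * B <= l ^+ m ->
  (n + m <= N)%N ->
  l ^+ m / 8 <= kappa ^+ m * \sum_(L ^ n <= k < L ^ (n + m)) P N k%:R.
Proof.
move=> en Bm nmN.
have h1 : l ^+ m / 4 <= \sum_(L ^ n <= k < L ^ (n + m)) P n k%:R.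
  have := sum_power_spectrum_ge n m; have := sum_power_spectrum_le n.
  rewrite (@big_cat_nat _ _ _ (L ^ n) 0 (L ^ (n + m)))//=; last first.
    by rewrite leq_pexp2l ?leq_addr//; exact: leq_trans L4.
  have : energy n / l ^+ n <= B by rewrite ler_pdivrMr.
  by lra.
rewrite mulr_sumr; have : l ^+ m / 8 <= \sum_(L ^ n <= k < L ^ (n + m)) P n k%:R / 2.
  by rewrite -mulr_suml; lra.
move=> /le_trans; apply; rewrite !big_nat; apply: ler_sum => k /andP[_ kL].
rewrite -(subnKC nmN) !power_spectrumD -[P n _ * _ * _]mulrA mulrCA.
rewrite ler_wpM2l ?power_spectrum_ge0//.
rewrite mulrA -[leLHS]mul1r ler_pM// ?power_spectrum_ge//.
rewrite -div1r power_spectrum_near0// normrM normfV normr_nat gtr0_norm//.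
by rewrite ler_pdivrMr// mul1r -natrX ler_nat ltnW.
Qed.

(* Each of the [I] disjoint frequency bands [L^(i m), L^((i + 1) m)) carries
   spectral mass at least [L^m / (8 kappa^m)]. *)
Lemma energy_growth m I (B : R) : 256 * B <= l ^+ m ->
  (forall n, (n <= I * m)%N -> energy n <= B * l ^+ n) ->
  I%:R <= 2 * kappa ^+ m.
Proof.
move=> Bm eB.
have L0 : (0 < L)%N by exact: leq_trans L4.
have h i : (i <= I)%N -> i%:R * (l ^+ m / 8) <=
    kappa ^+ m * \sum_(0 <= k < L ^ (i * m)) P (I * m) k%:R.
  elim: i => [_|i IH iI].
    rewrite mul0r mulr_ge0 ?exprn_ge0 ?(le_trans ler01 kappa_ge1)// sumr_ge0//.
    by move=> k _; exact: power_spectrum_ge0.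
  have le1 : (i * m <= I * m)%N by rewrite leq_mul2r ltnW ?orbT.
  have le2 : (i * m + m <= I * m)%N by rewrite -mulSnr leq_mul2r iI orbT.
  have := band_ge (eB _ le1) Bm le2; have := IH (ltnW iI).
  rewrite mulSnr -[i.+1%:R]natr1 mulrDl mul1r => h1 h2.
  rewrite (@big_cat_nat _ _ _ (L ^ (i * m)))//=; last first.
    by rewrite leq_pexp2l ?leq_addr.
  by rewrite mulrDr lerD.
(* The total mass at level I m is at most 64 B <= L^m/4, which limits the number of bands. *)
have := h I (leqnn _); have := sum_power_spectrum_le (I * m).
have : energy (I * m) / l ^+ (I * m) <= B by rewrite ler_pdivrMr ?eB.
move=> h1 h2 h3.
have h4 : \sum_(0 <= k < L ^ (I * m)) P (I * m) k%:R <= l ^+ m / 4 by lra.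
have k0 : 0 <= kappa ^+ m by rewrite exprn_ge0// (le_trans ler01 kappa_ge1).
have := le_trans h3 (ler_wpM2l k0 h4).
have -> : I%:R * (l ^+ m / 8) = (I%:R / 8) * l ^+ m by field.
by rewrite mulrCA [l ^+ m * _]mulrC ler_pM2r//; lra.
Qed.

End energy_growth.

(** * Stopping points in crowded cells *)

Section stopping_time.
Context {R : realType} (L : nat) (t : seq R) (K : R).
Context (sizet : size t = L) (L4 : (4 <= L)%N)
  (t4 : {in t, forall a, `|a| <= 1 / 4}) (K1 : 1 <= K).
Implicit Types (n m M N : nat) (U S : seq R) (u v x y : R).

Local Notation points := (points L t).
Local Notation energy := (energy L t).
Local Notation cell := (@cell R L).
Local Notation l := (L%:R : R).

Let l_gt0 n : 0 < l ^+ n. Proof. exact: exprL_gt0. Qed.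

Let l_ge4 : 4 <= l. Proof. by rewrite ler_nat. Qed.

Definition children n U : seq R := [seq x + l ^- n.+1 * a | x <- U, a <- t].

Definition crowd n S x : R := \sum_(y <- S) (cell n y == cell n x)%:R.

(* A point whose cell holds at least [K] points is stopped ([heavy]); only the
   other ones ([light]) have children.  [heavy n] lives at level [n.+1]. *)
Fixpoint light n : seq R :=
  if n is m.+1 then
    [seq x <- children m (light m) | ~~ (K <= crowd n (children m (light m)) x)]
  else [:: 0].

Definition heavy n : seq R :=
  [seq x <- children n (light n) | K <= crowd n.+1 (children n (light n)) x].

(** The relative mass not yet stopped at level n; 1 - [light_mass] is the beta of the overview. *)
Definition light_mass n : R := (size (light n))%:R / l ^+ n.

Lemma big_children n (F : R -> R) : \sum_(x <- children n (light n)) F x =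
  \sum_(x <- light n.+1) F x + \sum_(x <- heavy n) F x.
Proof.
rewrite [LHS](bigID (fun x => K <= crowd n.+1 (children n (light n)) x))/= addrC.
by rewrite !big_filter.
Qed.

(** Each parent has L children, all light or heavy. The stopped mass is thus a difference of
    consecutive light masses, and sums of it telescope. *)
Lemma size_heavy n :
  (size (heavy n))%:R = l ^+ n.+1 * (light_mass n - light_mass n.+1).
Proof.
have := big_children n (fun=> 1).
rewrite !sum_const_seq !mulr1 size_allpairs sizet natrM => h.
have n0 : l ^+ n != 0 by rewrite gt_eqF.
have n1 : l ^+ n.+1 != 0 by rewrite gt_eqF.
rewrite /light_mass mulrBr [_ * (_ / l ^+ n.+1)]mulrCA divff// mulr1.
by rewrite exprSr mulrAC mulrCA divff// mulr1 h addrC addKr.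
Qed.

Lemma light_massS n : light_mass n.+1 <= light_mass n.
Proof.
have : 0 <= l ^+ n.+1 * (light_mass n - light_mass n.+1) by rewrite -size_heavy.
by rewrite pmulr_rge0// subr_ge0.
Qed.

Lemma light_mass_le n m : (n <= m)%N -> light_mass m <= light_mass n.
Proof.
move=> /subnKC <-; elim: (m - n)%N => [|k IH]; first by rewrite addn0.
by rewrite addnS (le_trans (light_massS _)).
Qed.

Lemma light_mass_ge0 n : 0 <= light_mass n.
Proof. by rewrite divr_ge0// ltW. Qed.

Lemma light_mass0 : light_mass 0 = 1.
Proof. by rewrite /light_mass expr0 divr1. Qed.

(** A cell with a light point was not crowded even when all children were counted. At level 0 the
    single point uses K >= 1. *)
Lemma light_cell n j : \sum_(x <- light n) (cell n x == j)%:R <= K.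
Proof.
case: n => [|n]; first by rewrite big_seq1 (le_trans _ K1)// lern1 leq_b1.
have [/hasP[x xl /eqP xj]|/hasPn nl] :=
  boolP (has (fun x => cell n.+1 x == j) (light n.+1)).
  move: xl; rewrite mem_filter -ltNge => /andP[/ltW + _]; apply: le_trans.
  by rewrite /crowd big_children -xj lerDl sumr_ge0.
rewrite big1_seq ?(le_trans ler01)// => x /= /nl /negPf -> //.
Qed.

Lemma light_near n u : \sum_(x <- light n) (`|u - x| < l ^- n)%R%:R <= 3 * K.
Proof.
have h x : (`|u - x| < l ^- n)%R%:R <= (cell n x == cell n u - 1)%:R +
    (cell n x == cell n u)%:R + (cell n x == cell n u + 1)%:R :> R.
  have [ux|_] := boolP (`|u - x| < _); last by rewrite !addr_ge0.
  have : `|l ^+ n * u - l ^+ n * x| < 1%:~R.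
    by rewrite -mulrBr normrM gtr0_norm// mulrC -ltr_pdivlMr// div1r.
  move=> /floor_eq_near; rewrite -!/(cell n _) => h.
  have /or3P[] : [|| cell n x == cell n u - 1, cell n x == cell n u |
    cell n x == cell n u + 1] by lia.
  - by move=> ->; rewrite -addrA lerDl addr_ge0.
  - by move=> ->; rewrite addrAC lerDr addr_ge0.
  - by move=> ->; rewrite lerDr addr_ge0.
apply: le_trans (ler_sum _ (fun x _ => h x)) _.
rewrite !big_split/=.
have h1 := light_cell n (cell n u - 1).
have h2 := light_cell n (cell n u).
have h3 := light_cell n (cell n u + 1).
by lra.
Qed.

(** A child lies within L^-(n+1)/4 of its parent, so the relevant parents are within (2 + 1/4)
    L^-(n+1) < L^-n of u; each has L children. *)
Lemma children_near n u :
  \sum_(v <- children n (light n)) (`|u - v| < 2 * l ^- n.+1)%R%:R <= 3 * l * K.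
Proof.
rewrite /children big_allpairs_dep/=.
apply: (@le_trans _ _ (\sum_(x <- light n) l * (`|u - x| < l ^- n)%R%:R)).
  apply: ler_sum => x _.
  have -> c : l * c = \sum_(a <- t) c by rewrite sum_const_seq sizet.
  rewrite big_seq [leRHS]big_seq.
  apply: ler_sum => a /t4 a4; rewrite ler_nat.
  have [h|//] := boolP (`|_ - (_ + _)| < _).
  suff -> : `|u - x| < l ^- n by [].
  have -> : l ^- n = l * l ^- n.+1.
    by rewrite exprS invfM mulrA divff ?mul1r// gt_eqF//; have := l_ge4; lra.
  have := ler_normD (u - (x + l ^- n.+1 * a)) (l ^- n.+1 * a).
  have -> : u - (x + l ^- n.+1 * a) + l ^- n.+1 * a = u - x by ring.
  have i0 : 0 < l ^- n.+1 by rewrite invr_gt0.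
  rewrite normrM [`|l ^- _|]gtr0_norm// => h2.
  have : 4 * l ^- n.+1 <= l * l ^- n.+1 by rewrite ler_pM2r.
  have : l ^- n.+1 * `|a| <= l ^- n.+1 * (1 / 4) by rewrite ler_pM2l.
  by move: h i0 h2; set q := l ^- _; lra.
by rewrite -mulr_sumr mulrAC mulrC ler_pM2r ?light_near//; have := l_ge4; lra.
Qed.

Definition collide n M u v : R := \sum_(y <- points M) \sum_(z <- points M)
  (cell (n + M) (u + l ^- n * y) == cell (n + M) (v + l ^- n * z))%:R.

Lemma collide_ge0 n M u v : 0 <= collide n M u v.
Proof. by apply: sumr_ge0 => ? _; apply: sumr_ge0. Qed.

Lemma collideC n M u v : collide n M u v = collide n M v u.
Proof.
rewrite /collide exchange_big/=; apply: eq_bigr => y _.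
by apply: eq_bigr => z _; rewrite eq_sym.
Qed.

Lemma cell_split n M u y :
  cell (n + M) (u + l ^- n * y) = Num.floor (l ^+ M * y + l ^+ (n + M) * u).
Proof.
rewrite /cell; congr Num.floor; rewrite mulrDr addrC; congr (_ + _).
by rewrite exprD; field; rewrite gt_eqF.
Qed.

(** Rounding moves the difference of cell indices by at most 1, so only the shifts d - 1, d and d +
    1 occur, and [sum_cell_shift] bounds each. *)
Lemma collide_le n M u v : collide n M u v <= 3 * energy M.
Proof.
pose d := Num.floor (l ^+ (n + M) * v) - Num.floor (l ^+ (n + M) * u).
have h y z : (cell (n + M) (u + l ^- n * y) == cell (n + M) (v + l ^- n * z))%:R <=
    (cell M y == cell M z + (d - 1))%:R + (cell M y == cell M z + d)%:R +
    (cell M y == cell M z + (d + 1))%:R :> R.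
  have [|_] := boolP (_ == _); last by rewrite !addr_ge0.
  rewrite !cell_split => /eqP e.
  have e1 := floorD_cases (l ^+ M * y) (l ^+ (n + M) * u).
  have e2 := floorD_cases (l ^+ M * z) (l ^+ (n + M) * v).
  have /or3P[] : [|| cell M y == cell M z + (d - 1), cell M y == cell M z + d |
      cell M y == cell M z + (d + 1)].
    move: e1 e2; rewrite e /cell /d.
    by move=> /orP[]/eqP-> /orP[]/eqP; lia.
  - by move=> ->; rewrite -addrA lerDl addr_ge0.
  - by move=> ->; rewrite addrAC lerDr addr_ge0.
  - by move=> ->; rewrite lerDr addr_ge0.
apply: le_trans.
  by apply: ler_sum => y _; apply: ler_sum => z _; exact: h.
under eq_bigr do rewrite !big_split/=.
rewrite !big_split/=.
have h1 := sum_cell_shift L t M (d - 1).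
have h2 := sum_cell_shift L t M d.
have h3 := sum_cell_shift L t M (d + 1).
by lra.
Qed.

(** Descendants in one cell are less than L^-n apart and their tails differ by at most L^-n/2, so
    distant u and v have no coincidences. *)
Lemma collide_near n M u v :
  collide n M u v <= 3 * energy M * (`|u - v| < 2 * l ^- n)%R%:R.
Proof.
have [_|uv] := boolP (`|_| < _); first by rewrite mulr1 collide_le.
rewrite mulr0 /collide big1_seq// => y /= yM; rewrite big1_seq// => z /= zM.
apply/eqP; rewrite pnatr_eq0 eqb0; apply: contra uv => /eqP /floor_near_eq.
rewrite -mulrBr normrM gtr0_norm// exprD => h.
have yz : `|y - z| <= 1 / 2 by have := points_dist L4 t4 yM zM.
have h2 : l ^+ n * `|u + l ^- n * y - (v + l ^- n * z)| < 1.
  apply: le_lt_trans h; rewrite mulrAC; apply: ler_peMr; last exact: exprL_ge1.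
  by rewrite mulr_ge0// ltW.
have i0 : 0 < l ^- n by rewrite invr_gt0.
have h3 : `|u + l ^- n * y - (v + l ^- n * z)| < l ^- n.
  by rewrite -[ltRHS]mulr1 ltr_pdivlMl.
have := ler_normD (u + l ^- n * y - (v + l ^- n * z)) (l ^- n * (z - y)).
have -> : u + l ^- n * y - (v + l ^- n * z) + l ^- n * (z - y) = u - v by ring.
rewrite normrM [`|l ^- _|]gtr0_norm// [`|z - y|]distrC => h4.
have : l ^- n * `|y - z| <= l ^- n * (1 / 2) by rewrite ler_pM2l.
by move: h3 h4 i0; set q := l ^- _; lra.
Qed.

Lemma sum_collide_le n M u :
  \sum_(v <- children n (light n)) collide n.+1 M u v <= 9 * l * K * energy M.
Proof.
apply: le_trans (ler_sum _ (fun v _ => collide_near n.+1 M u v)) _.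
rewrite -mulr_sumr.
have := ler_wpM2l (mulr_ge0 (ler0n R 3) (energy_ge0 L t M)) (children_near n u).
by move/le_trans; apply; rewrite le_eqVlt; apply/orP; left; apply/eqP; ring.
Qed.

Definition pair_energy n M U : R := \sum_(u <- U) \sum_(v <- U) collide n M u v.

Lemma collideS n M u v : collide n M.+1 u v =
  \sum_(a <- t) \sum_(b <- t) collide n.+1 M (u + l ^- n.+1 * a) (v + l ^- n.+1 * b).
Proof.
rewrite /collide big_points; apply: eq_bigr => a _.
rewrite exchange_big/= big_points; apply: eq_bigr => b _.
rewrite exchange_big/=; apply: eq_bigr => y _; apply: eq_bigr => z _.
have E (x c d : R) : x + l ^- n * (l^-1 * (c + d)) = x + l ^- n.+1 * c + l ^- n.+1 * d.
  by rewrite exprSr invfM; ring.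
by rewrite !E addSnnS.
Qed.

Lemma pair_energyS n M U :
  pair_energy n M.+1 U = pair_energy n.+1 M (children n U).
Proof.
rewrite /pair_energy [RHS]big_allpairs_dep/=; apply: eq_bigr => u _.
under eq_bigr do rewrite collideS.
rewrite exchange_big/=; apply: eq_bigr => a _.
by rewrite [RHS]big_allpairs_dep/=.
Qed.

(** Pairs of light children are kept. Any other pair has a heavy child in the first or second place;
    [sum_collide_le] bounds either kind, whence 18 = 2 * 9. *)
Lemma pair_energy_step n M : pair_energy n M.+1 (light n) <=
  pair_energy n.+1 M (light n.+1) + (size (heavy n))%:R * (18 * l * K * energy M).
Proof.
rewrite pair_energyS /pair_energy big_children.
under eq_bigr do rewrite big_children.
rewrite big_split/= -addrA lerD2l.
rewrite exchange_big/=.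
have h : \sum_(u <- heavy n) \sum_(v <- children n (light n)) collide n.+1 M u v <=
    (size (heavy n))%:R * (9 * l * K * energy M).
  by rewrite -sum_const_seq; apply: ler_sum => u _; exact: sum_collide_le.
have h' : \sum_(u <- heavy n) \sum_(v <- light n.+1) collide n.+1 M v u <=
    \sum_(u <- heavy n) \sum_(v <- children n (light n)) collide n.+1 M u v.
  apply: ler_sum => u _; rewrite big_children.
  under eq_bigr do rewrite collideC.
  by rewrite lerDl sumr_ge0// => v _; exact: collide_ge0.
have -> : (size (heavy n))%:R * (18 * l * K * energy M) =
    (size (heavy n))%:R * (9 * l * K * energy M) +
    (size (heavy n))%:R * (9 * l * K * energy M) by ring.
exact: lerD (le_trans h' h) h.
Qed.

(** Descend one level at a time: the heavy contributions, bounded through lower energies, telescope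
    by [size_heavy]. At the last level a light point shares its cell with at most K light points. *)
Lemma pair_energy_le n M (B : R) :
  (forall m, (m < M)%N -> energy m <= B * l ^+ m) ->
  pair_energy n M (light n) <= l ^+ (n + M) *
    (K + 18 * l * K * B * (light_mass n - light_mass (n + M))).
Proof.
elim: M n => [|M IH] n eB.
  rewrite addn0 subrr mulr0 addr0.
  apply: (@le_trans _ _ ((size (light n))%:R * K)).
    rewrite -sum_const_seq /pair_energy; apply: ler_sum => u _.
    rewrite /collide; under eq_bigr do rewrite !big_seq1 addn0 !mulr0 !addr0 eq_sym.
    exact: light_cell.
  rewrite ler_pM2r ?(lt_le_trans ltr01)// -[leRHS]mul1r -ler_pdivrMr//.
  by have := light_mass_le (leq0n n); rewrite light_mass0.
apply: le_trans (pair_energy_step n M) _.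
have h1 := IH n.+1 (fun m mM => eB m (ltnW mM)).
have h2 : (size (heavy n))%:R * (18 * l * K * energy M) <=
    (size (heavy n))%:R * (18 * l * K * (B * l ^+ M)).
  by rewrite ler_wpM2l// ler_wpM2l ?eB// !mulr_ge0// (le_trans ler01).
apply: le_trans (lerD h1 h2) _.
rewrite size_heavy addSnnS addnS exprS exprD exprS.
by rewrite le_eqVlt; apply/orP; left; apply/eqP; ring.
Qed.

(** Bootstrap: if the lower levels satisfy the bound, [pair_energy_le] with B = 2 K gives K (1 + 36
    L K (1 - [light_mass n])) L^n, and the hypothesis makes the bracket at most 2. *)
Lemma energy_le N : 36 * l * K * (1 - light_mass N) <= 1 ->
  forall n, (n <= N)%N -> energy n <= 2 * K * l ^+ n.
Proof.
move=> hN; elim/ltn_ind => n IH nN.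
have := @pair_energy_le 0 n (2 * K) (fun m mn => IH m mn (leq_trans (ltnW mn) nN)).
rewrite /pair_energy !big_seq1 light_mass0 add0n.
have -> : collide 0 n 0 0 = energy n.
  apply: eq_bigr => y _; apply: eq_bigr => z _.
  by rewrite expr0 invr1 !mul1r !add0r.
move/le_trans; apply; rewrite mulrC ler_pM2r//.
have K0 : 0 < K := lt_le_trans ltr01 K1.
have h : 36 * l * K * (1 - light_mass n) <= 1.
  apply: le_trans hN; apply: ler_wpM2l; last by rewrite lerB// light_mass_le.
  by rewrite !mulr_ge0// ltW.
have -> : K + 18 * l * K * (2 * K) * (1 - light_mass n) =
  K * (1 + 36 * l * K * (1 - light_mass n)) by ring.
by rewrite mulrC ler_pM2r//; lra.
Qed.

End stopping_time.

(** * Covering by blocks of levels *)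

Section covering.
Context {R : realType} (L : nat) (t : seq R).
Context (sizet : size t = L) (L4 : (4 <= L)%N)
  (t4 : {in t, forall a, `|a| <= 1 / 4}).
Implicit Types (n m M N : nat) (S : seq R).

Local Notation points := (points L t).
Local Notation l := (L%:R : R).

Let l_gt0 n : 0 < l ^+ n. Proof. exact: exprL_gt0. Qed.

Let l_gt0' n : 0 < l ^- n. Proof. by rewrite invr_gt0. Qed.

Let l_neq0 n : l ^+ n != 0. Proof. by rewrite gt_eqF. Qed.

Let normM n (x : R) : l ^+ n * `|x| = `|l ^+ n * x|.
Proof. by rewrite normrM gtr0_norm. Qed.

(** Intervals of radius L^-n with arbitrary centres; the count is bounded by a real so that
    fractions of L^n can be tracked. *)
Definition covered n S (r : R) : Prop := exists2 s : seq R, (size s)%:R <= r &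
  forall x, x \in S -> exists2 c, c \in s & `|x - c| <= l ^- n.

Lemma covered_cat n S1 S2 S r1 r2 :
  (forall x, x \in S -> (x \in S1) || (x \in S2)) ->
  covered n S1 r1 -> covered n S2 r2 -> covered n S (r1 + r2).
Proof.
move=> sub [s1 s1r h1] [s2 s2r h2]; exists (s1 ++ s2).
  by rewrite size_cat natrD lerD.
move=> x /sub /orP[/h1|/h2] [c cs xc]; exists c => //.
  by rewrite mem_cat cs.
by rewrite mem_cat cs orbT.
Qed.

Lemma covered_self n S : covered n S (size S)%:R.
Proof. by exists S => // x xS; exists x => //; rewrite subrr normr0 ltW. Qed.

Lemma covered_le n S r1 r2 : covered n S r1 -> r1 <= r2 -> covered n S r2.
Proof. by move=> [s sr h] r12; exists s => //; exact: le_trans r12. Qed.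

Definition grid w n M (a : R) : seq R :=
  [seq a + l ^- (n + M) * i%:R | i <- iota 0 (w * L ^ M)].

Lemma grid_near w n M (a z : R) : 0 <= l ^+ n * (z - a) < w%:R ->
  exists2 c, c \in grid w n M a & `|z - c| <= l ^- (n + M).
Proof.
move=> /andP[z0 zw].
have zM : 0 <= l ^+ (n + M) * (z - a) by rewrite addnC exprD -mulrA mulr_ge0// ltW.
have /andP[i1 i2] := truncn_itv zM; set i := Num.truncn _ in i1 i2.
exists (a + l ^- (n + M) * i%:R).
  apply/mapP; exists i => //; rewrite mem_iota add0n/= -(ltr_nat R).
  apply: le_lt_trans i1 _; rewrite natrM natrX exprD mulrAC.
  by rewrite ltr_pM2r.
rewrite -(ler_pM2l (l_gt0 (n + M))) divff//.
rewrite normM mulrBr mulrDr mulVKf// ler_norml.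
move: i1 i2; rewrite mulrBr -natr1; lra.
Qed.

Definition descendants n M S : seq R :=
  [seq x + l ^- n * y | x <- S, y <- points M].

Lemma descendants_near n M S z : z \in descendants n M S ->
  exists2 x, x \in S & l ^+ n * `|z - x| <= 1 / 4.
Proof.
move=> /allpairsP[[x y] /= [xS /(points_le L4 t4) y4 ->]]; exists x => //.
by rewrite addrAC subrr add0r normrM gtr0_norm// mulVKf.
Qed.

Lemma mem_points_split n k z : z \in points (n + k) ->
  z \in descendants n k (points n).
Proof.
elim: n z => [|n IH] z.
  move=> zk; apply/allpairsP; exists (0, z); split => //=; first exact: mem_head.
  by rewrite expr0 invr1 mul1r add0r.
move=> /allpairsP[[a y] /= [at_ /IH /allpairsP[[x w] /= [xn wk ->]] ->]].
apply/allpairsP; exists (l^-1 * (a + x), w); split => //=.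
  by apply/allpairsP; exists (a, x).
by rewrite exprS invfM !mulrDr !addrA mulrA.
Qed.

Lemma covered_descendants n M S r : covered M (points M) r ->
  covered (n + M) (descendants n M S) ((size S)%:R * r).
Proof.
move=> [s sr h]; exists [seq x + l ^- n * c | x <- S, c <- s].
  by rewrite size_allpairs natrM ler_wpM2l.
move=> _ /allpairsP[[x y] /= [xS /h [c cs yc] ->]].
exists (x + l ^- n * c); first by apply/allpairsP; exists (x, c).
have -> : x + l ^- n * y - (x + l ^- n * c) = l ^- n * (y - c) by ring.
by rewrite normrM gtr0_norm// exprD invfM ler_pM2l.
Qed.

Lemma covered_extend n M r : covered n (points n) r ->
  covered (n + M) (points (n + M)) (4 * l ^+ M * r).
Proof.
move=> [s sr h].
(* A point of level n is within one cell width of its centre c and its descendants at most 1/4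
   further, so a window of 4 cells around c suffices. *)
exists (flatten [seq grid 4 n M (c - 2 * l ^- n) | c <- s]).
  have -> : size (flatten [seq grid 4 n M (c - 2 * l ^- n) | c <- s]) =
      (size s * (4 * L ^ M))%N.
    elim: (s) => //= c s' IH.
    by rewrite size_cat IH size_map size_iota mulSn.
  by rewrite natrM mulrC natrM natrX ler_wpM2l// mulr_ge0// ltW.
move=> z /mem_points_split /descendants_near[x /h[c cs xc] zx].
have xc' : l ^+ n * `|x - c| <= 1.
  by rewrite mulrC -ler_pdivlMr// div1r.
have := @grid_near 4 n M (c - 2 * l ^- n) z.
have E : l ^+ n * (z - (c - 2 * l ^- n)) = l ^+ n * (z - x) + l ^+ n * (x - c) + 2.
  by field.
case.
  rewrite E; move: xc' zx.
  rewrite !normM !ler_norml.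
  by move=> /andP[? ?] /andP[? ?]; lra.
move=> c' c'g zc'; exists c' => //; apply/flattenP.
by exists (grid 4 n M (c - 2 * l ^- n)) => //; exact: map_f.
Qed.

Section blocks.
Variable K : R.
Hypothesis K1 : 1 <= K.

Local Notation light := (light L t K).
Local Notation heavy := (heavy L t K).
Local Notation light_mass := (light_mass L t K).
Local Notation cell := (@cell R L).

Lemma crowd_eq n S x y : cell n x = cell n y -> crowd L n S x = crowd L n S y.
Proof. by rewrite /crowd => ->. Qed.

(** Being stopped depends on the cell alone, so the whole crowd around a heavy point is heavy. *)
Lemma heavy_cell n x : x \in heavy n ->
  K <= \sum_(y <- heavy n) (cell n.+1 y == cell n.+1 x)%:R.
Proof.
rewrite mem_filter => /andP[Kx xc]; apply: (le_trans Kx).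
rewrite {1}/crowd big_children big1_seq ?add0r// => y /=.
rewrite mem_filter => /andP[yK _]; case: eqP => // yx.
by move: yK; rewrite (crowd_eq _ yx) Kx.
Qed.

(** Heavy points occupy their cells at least K at a time, hence at most (size heavy)/K cells. *)
Lemma covered_heavy n M : covered (n.+1 + M) (descendants n.+1 M (heavy n))
  (3 * l ^+ M * ((size (heavy n))%:R / K)).
Proof.
have K0 : 0 < K := lt_le_trans ltr01 K1.
pose D := undup [seq cell n.+1 x | x <- heavy n].
have sD : (size D)%:R <= (size (heavy n))%:R / K.
  rewrite ler_pdivlMr// -sum_const_seq.
  have -> : (size (heavy n))%:R =
      \sum_(j <- D) \sum_(x <- heavy n) (cell n.+1 x == j)%:R :> R.
    rewrite exchange_big/= -[LHS]mulr1 -sum_const_seq; apply: eq_big_seq => x xh.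
    by rewrite sum_indicator_uniq ?undup_uniq// mem_undup map_f.
  rewrite big_seq [leRHS]big_seq; apply: ler_sum => j.
  by rewrite mem_undup => /mapP[x xh ->]; exact: heavy_cell.
(* Descendants leave the cell j by at most a quarter of its width, so a window of 3 cells starting
   at j - 1 contains them. *)
pose a (j : int) := l ^- n.+1 * (j - 1)%:~R.
exists (flatten [seq grid 3 n.+1 M (a j) | j <- D]).
  have -> : size (flatten [seq grid 3 n.+1 M (a j) | j <- D]) =
      (size D * (3 * L ^ M))%N.
    elim: (D) => //= j D' IH.
    by rewrite size_cat IH size_map size_iota mulSn.
  by rewrite natrM mulrC natrM natrX ler_wpM2l// mulr_ge0// ltW.
move=> z /descendants_near[x xh zx].
have := @grid_near 3 n.+1 M (a (cell n.+1 x)) z.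
have E : l ^+ n.+1 * (z - a (cell n.+1 x)) =
    l ^+ n.+1 * (z - x) + (l ^+ n.+1 * x - (cell n.+1 x)%:~R) + 1.
  rewrite /a mulrBr [_ * (l ^- _ * _)]mulrA divff// intrB; ring.
case.
  rewrite E; have /andP[] := floor_itv (l ^+ n.+1 * x); rewrite -/(cell n.+1 x).
  move: zx; rewrite normM ler_norml intrD.
  by move=> /andP[? ?] ? ?; lra.
move=> c' c'g zc'; exists c' => //; apply/flattenP.
exists (grid 3 n.+1 M (a (cell n.+1 x))) => //; apply: map_f.
by rewrite mem_undup map_f.
Qed.

Lemma descendantsS n M z : z \in descendants n M.+1 (light n) ->
  (z \in descendants n.+1 M (light n.+1)) || (z \in descendants n.+1 M (heavy n)).
Proof.
move=> /allpairsP[[x w] /= [xn /allpairsP[[a y] /= [ta yM ->]] ->]].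
have xc : x + l ^- n.+1 * a \in children L t n (light n).
  by apply/allpairsP; exists (x, a).
have -> : x + l ^- n * (l^-1 * (a + y)) = x + l ^- n.+1 * a + l ^- n.+1 * y.
  by rewrite exprSr invfM; ring.
apply/orP; case: (boolP (K <= crowd L n.+1 (children L t n (light n))
    (x + l ^- n.+1 * a))) => h; [right|left].
  by apply/allpairsP; exists (x + l ^- n.+1 * a, y); rewrite mem_filter h.
by apply/allpairsP; exists (x + l ^- n.+1 * a, y); rewrite mem_filter h.
Qed.

(** Points stopped during the k levels are covered by [covered_heavy], with masses that telescope;
    the survivors reuse the given cover for their last M levels. *)
Lemma covered_light M r n k : covered M (points M) (r * l ^+ M) ->
  covered (n + (k + M)) (descendants n (k + M) (light n))
    (l ^+ (n + (k + M)) * (3 * (light_mass n - light_mass (n + k)) / K +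
      light_mass (n + k) * r)).
Proof.
move=> cM; elim: k n => [|k IH] n.
  rewrite add0n addn0 subrr mulr0 mul0r add0r.
  apply: covered_le (@covered_descendants n M (light n) _ cM) _.
  rewrite /light_mass exprD le_eqVlt; apply/orP; left; apply/eqP; field.
  exact: l_neq0.
have := covered_heavy n (k + M); rewrite size_heavy// => ch.
have := covered_cat (@descendantsS n (k + M)) (IH n.+1) ch.
rewrite -[(k.+1 + M)%N]/((k + M).+1) -[(n + (k + M).+1)%N]addSnnS.
rewrite -[(n + k.+1)%N]addSnnS => /covered_le; apply; rewrite [l ^+ (n.+1 + _)]exprD.
rewrite le_eqVlt; apply/orP; left; apply/eqP; field.
by rewrite gt_eqF// (lt_le_trans ltr01 K1).
Qed.

Lemma covered_block M r N : covered M (points M) (r * l ^+ M) ->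
  covered (N + M) (points (N + M))
    ((3 * (1 - light_mass N) / K + light_mass N * r) * l ^+ (N + M)).
Proof.
move=> /(@covered_light M r 0 N); rewrite !add0n light_mass0 mulrC => -[s sr h].
exists s => // x xp; apply: h; apply/allpairsP; exists (0, x); split => //=.
  exact: mem_head.
by rewrite expr0 invr1 mul1r add0r.
Qed.

(** With b = [light_mass N], a block maps r to 3 (1 - b)/K + b r. The fixed point is 3/K, and each
    block multiplies the deviation from it by b. *)
Lemma covered_blocks N q : covered (q * N) (points (q * N))
  ((3 / K + light_mass N ^+ q) * l ^+ (q * N)).
Proof.
have K0 : 0 < K := lt_le_trans ltr01 K1.
elim: q => [|q IH].
  apply: covered_le (covered_self _ _) _.
  by rewrite size_points// natrX ler_peMl ?(ltW (l_gt0 _))// expr0 lerDr divr_ge0// ltW.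
have := covered_block N IH; rewrite mulSn => /covered_le; apply.
apply: ler_wpM2r; first exact: ltW.
rewrite exprS le_eqVlt; apply/orP; left; apply/eqP; field.
by rewrite gt_eqF.
Qed.

End blocks.
End covering.

(** * Choice of scales *)

Section scales.
Context {R : realType}.

Lemma bernoulli_le (x : R) n : 0 <= x -> 1 + n%:R * x <= (1 + x) ^+ n.
Proof.
move=> x0; elim: n => [|n IH]; first by rewrite mul0r addr0.
rewrite exprS -natr1; apply: (@le_trans _ _ ((1 + x) * (1 + n%:R * x))).
  by have := mulr_ge0 (mulr_ge0 (ler0n R n) x0) x0; nra.
by rewrite ler_wpM2l// addr_ge0.
Qed.

(** Since b (1 + (1 - b)) <= 1, Bernoulli gives b^q (1 + q (1 - b)) <= 1, where the bracket is at
    least 2. *)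
Lemma exprn_half (b : R) q : 0 <= b -> 1 <= q%:R * (1 - b) -> b ^+ q <= 2^-1.
Proof.
move=> b0 qb.
have b1 : 0 <= 1 - b.
  by case: (ltP (1 - b) 0) => // b1; have := ler0n R q; nra.
have h := bernoulli_le q b1.
have h2 : (b * (1 + (1 - b))) ^+ q <= 1.
  by rewrite exprn_ile1//; nra.
rewrite -(ler_pM2r (_ : 0 < 2)) ?mulVf//.
by apply: le_trans h2; rewrite exprMn ler_wpM2l ?exprn_ge0//; lra.
Qed.

Lemma sqr_le_exprn (b : R) : 1 < b ->
  exists2 c, 0 < c & forall n, n%:R ^+ 2 <= c * b ^+ n.
Proof.
move=> b1; pose x := Num.sqrt b - 1.
have x0 : 0 < x by rewrite subr_gt0 -sqrtr1 ltr_sqrt// (lt_trans ltr01).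
exists (x ^- 2) => [|n]; first by rewrite invr_gt0 exprn_gt0.
rewrite mulrC ler_pdivlMr ?exprn_gt0//.
have -> : b ^+ n = ((1 + x) ^+ n) ^+ 2.
  by rewrite /x addrC subrK exprAC sqr_sqrtr// ltW// (lt_trans ltr01).
have x1 : 0 <= (1 + x) ^+ n by rewrite exprn_ge0// addr_ge0// ltW.
rewrite -exprMn lerXn2r ?nnegrE ?mulr_ge0 ?(ltW x0)//.
by have := bernoulli_le n (ltW x0); lra.
Qed.

(** If u >= p, the exponent of N is nonnegative and m = 0 serves. Otherwise take m maximal: then N <
    a (m + 1)^2 b^(m + 1), and the power p - u turns b^p into l and leaves (m + 1)^2 b^(-u (m + 1)),
    bounded by [sqr_le_exprn]. *)
Lemma choose_scale (l b p u a : R) : 1 < l -> 1 < b -> b `^ p = l ->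
  0 < p <= 1 -> 0 < u -> 1 <= a ->
  exists2 C, 0 <= C & forall N, (1 <= N)%N ->
    exists2 m, a * m%:R ^+ 2 * b ^+ m <= N%:R & l ^- m <= C * N%:R `^ (- p + u).
Proof.
move=> l1 b1 bp /andP[p0 p1] u0 a1.
have [up|pu] := leP p u.
  exists 1 => // N N1; exists 0; first by rewrite expr0n mulr0 mul0r.
  have N1R : 1 <= N%:R :> R by rewrite ler1n.
  have := @ler_powR _ _ N1R 0 (- p + u); rewrite powRr0 expr0 invr1 mul1r; apply.
  by lra.
have l0 : 0 < l by rewrite (lt_trans ltr01).
have b0 : 0 < b by rewrite (lt_trans ltr01).
have bu1 : 1 < b `^ u.
  have := gt0_ltr_powR u0 _ _ b1; rewrite powR1 !nnegrE.
  by apply=> //; exact: ltW.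
have [c c0 hc] := sqr_le_exprn bu1.
exists (a * c * l); first by rewrite !mulr_ge0// ?ltW// (lt_le_trans ltr01).
move=> N N1.
pose P m := a * m%:R ^+ 2 * b ^+ m <= N%:R.
have P0 : exists m, P m by exists 0; rewrite /P expr0n mulr0 mul0r.
have Pmax m : P m -> (m <= N)%N.
  rewrite /P -(ler_nat R) => /(le_trans _); apply.
  have [->|m0] := posnP m; first by rewrite expr0n mulr0 mul0r.
  have bm : 1 <= b ^+ m by rewrite exprn_ege1 ?ltW.
  have mm : m%:R <= m%:R ^+ 2 :> R by rewrite -natrX ler_nat -{1}[m]expn1 leq_pexp2l.
  have am : m%:R ^+ 2 <= a * m%:R ^+ 2 by rewrite ler_peMl// sqr_ge0.
  apply: le_trans mm (le_trans am _).
  by rewrite ler_peMr// mulr_ge0 ?sqr_ge0// (le_trans ler01).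
case: (ex_maxnP P0 Pmax) => m Pm mmax; exists m => //.
have : N%:R < a * m.+1%:R ^+ 2 * b ^+ m.+1.
  by rewrite ltNge; apply/negP => /mmax; rewrite ltnn.
have N0 : 0 < N%:R :> R by rewrite ltr0n.
move=> /ltW; set n := m.+1 => Nn.
have n0 : 0 <= a * n%:R ^+ 2 by rewrite mulr_ge0 ?sqr_ge0// (le_trans ler01).
have n1 : 1 <= a * n%:R ^+ 2.
  by rewrite -[leLHS]mulr1 ler_pM// -natrX ler1n expn_gt0.
have v0 : 0 <= p - u by rewrite subr_ge0 ltW.
have Nv : N%:R `^ (p - u) <= (a * c * l) * l ^+ m.
  apply: (@le_trans _ _ ((a * n%:R ^+ 2 * b ^+ n) `^ (p - u))).
    apply: ge0_ler_powR; rewrite ?nnegrE ?mulr_ge0 ?exprn_ge0 ?(ltW N0) ?(ltW b0)//.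
    exact: le_trans a1.
  rewrite powRM//; last by rewrite exprn_ge0// ltW.
  have h1 : (a * n%:R ^+ 2) `^ (p - u) <= a * n%:R ^+ 2.
    by rewrite -[leRHS]powRr1// ler_powR//; lra.
  have h2 : (b ^+ n) `^ (p - u) = l ^+ n / (b `^ u) ^+ n.
    rewrite -powR_mulrn ?(ltW b0)// -powRrM mulrC powRrM.
    rewrite powRB ?(gt_eqF b0) ?implybT// bp powR_mulrn ?expr_div_n//.
    by rewrite divr_ge0 ?powR_ge0 ?(ltW l0).
  rewrite h2; apply: le_trans (ler_wpM2r _ h1) _.
    by rewrite divr_ge0 ?exprn_ge0 ?powR_ge0// ltW.
  have bn0 : 0 < (b `^ u) ^+ n by rewrite exprn_gt0// powR_gt0.
  rewrite mulrA ler_pdivrMr//.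
  have := ler_wpM2l (mulr_ge0 (le_trans ler01 a1) (exprn_ge0 n (ltW l0))) (hc n).
  have -> : a * c * l * l ^+ m * (b `^ u) ^+ n =
      a * (l * l ^+ m) * (c * (b `^ u) ^+ n).
    by ring.
  by rewrite -exprS mulrAC.
have -> : - p + u = - (p - u) by ring.
rewrite powRN ler_pdivlMr ?powR_gt0// mulrC ler_pdivrMr ?exprn_gt0//.
Qed.

End scales.

(** * Covering the projected points at a given scale *)

Section covering_bound.
Context {R : realType} (L : nat) (t : seq R) (kappa : R).
Context (sizet : size t = L) (L4 : (4 <= L)%N)
  (t4 : {in t, forall a, `|a| <= 1 / 4})
  (kappa_t : forall xi, L%:R ^+ 2 <= kappa * cos_energy t xi).

Local Notation l := (L%:R : R).

(** If a block of M levels stopped too little mass, [energy_le] would keep its energies low and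
    contradict [energy_growth]. So every block stops a definite fraction, q blocks leave at most
    L^-m, and the hypothesis on N makes room for q M levels. *)
Lemma covered_scale m N :
  3 * l ^+ 2 * m%:R ^+ 2 * (l * kappa) ^+ m <= N%:R ->
  covered L N (points L t N) (6148 / l ^+ m * l ^+ N).
Proof.
have l0 n : 0 < l ^+ n by exact: exprL_gt0.
have ge0l n : 0 <= l ^+ n by exact: ltW.
have k1 := kappa_ge1 sizet L4 kappa_t.
move=> hN; have [small|big] := ltP (l ^+ m) 512.
  apply: covered_le (covered_self _ _ _) _ => //.
  by rewrite size_points// natrX ler_peMl// ler_pdivlMr//; lra.
(* This makes 256 * (2 K) = L^m, the borderline case of [energy_growth]. *)
pose K := l ^+ m / 512.
have K1 : 1 <= K by rewrite /K; lra.
(* More bands than [energy_growth] allows. *)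
pose I := (Num.truncn (2 * kappa ^+ m)).+1.
have km1 : 1 <= kappa ^+ m by rewrite exprn_ege1.
have km0 : 0 <= 2 * kappa ^+ m by lra.
have /andP[I1 I2] := truncn_itv km0.
have I3 : I%:R <= 3 * kappa ^+ m by rewrite /I -natr1; lra.
pose M := (I * m)%N; pose b := light_mass L t K M.
have b0 : 0 <= b by exact: light_mass_ge0.
have hb : 1 < 36 * l * K * (1 - b).
  rewrite ltNge; apply/negP => /(energy_le sizet L4 t4 K1) eB.
  have := @energy_growth R L t kappa sizet L4 t4 kappa_t m I (2 * K) _ eB.
  by move/(_ ltac:(rewrite /K; lra)); rewrite leNgt I2.
pose q0 := (L ^ m.+1)%N.
have hq0 : 1 <= q0%:R * (1 - b).
  have -> : q0%:R * (1 - b) = 512 / 36 * (36 * l * K * (1 - b)).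
    by rewrite /q0 natrX /K exprS; field.
  by lra.
have bq0 := exprn_half b0 hq0.
(* Each group of q0 blocks halves the surviving mass, and 2^-L <= 1/L, so m L groups bring it below
   L^-m. *)
pose q := (q0 * (m * L))%N.
have bq : b ^+ q <= l ^- m.
  rewrite /q exprM; apply: (@le_trans _ _ (2^-1 ^+ (m * L))).
    by rewrite lerXn2r// ?nnegrE ?exprn_ge0.
  have l2 : 2^-1 ^+ L <= l^-1.
    rewrite exprVn lef_pV2 ?posrE ?exprn_gt0//; last exact: (l0 1).
    by rewrite -natrX ler_nat ltnW// ltn_expl.
  by rewrite mulnC exprM -exprVn lerXn2r// ?nnegrE ?exprn_ge0 ?invr_ge0.
have := covered_blocks sizet L4 t4 K1 M q; rewrite -/b => cb.
have qN : (q * M <= N)%N.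
  rewrite -(ler_nat R); apply: le_trans hN.
  rewrite /q /M /q0 !natrM natrX exprMn.
  have -> : l ^+ m.+1 * (m%:R * l) * (I%:R * m%:R) =
    (l ^+ 2 * m%:R ^+ 2 * l ^+ m) * I%:R.
    by rewrite exprS; ring.
  have -> : 3 * l ^+ 2 * m%:R ^+ 2 * (l ^+ m * kappa ^+ m) =
    (l ^+ 2 * m%:R ^+ 2 * l ^+ m) * (3 * kappa ^+ m) by ring.
  by rewrite ler_wpM2l// !mulr_ge0// ?sqr_ge0.
(* The leftover levels cost a factor 4, and 6148 = 4 (3 * 512 + 1). *)
have := covered_extend L4 t4 (N - q * M) cb; rewrite subnKC// => /covered_le; apply.
have -> : 4 * l ^+ (N - q * M) * ((3 / K + b ^+ q) * l ^+ (q * M)) =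
    4 * (3 / K + b ^+ q) * (l ^+ (q * M) * l ^+ (N - q * M)) by ring.
rewrite -exprD subnKC// ler_wpM2r//.
have -> : 3 / K = 1536 * l ^- m by rewrite /K; field; rewrite gt_eqF.
lra.
Qed.

End covering_bound.

(** * Hausdorff measure and integrals *)

Section hausdorff_bound.
Context {R : realType}.
Implicit Types E : set R.

Lemma diam_ge0 E : (0 <= diam E)%E.
Proof. by apply: ereal_sup_ubound; left. Qed.

Lemma diam_le E (p w : R) : 0 <= w -> E `<=` `[p, p + w]%classic ->
  (diam E <= w%:E)%E.
Proof.
move=> w0 Ew; apply: ge_ereal_sup => _ [->|[[x y] [/= Ex Ey] <-]].
  by rewrite lee_fin.
move: (Ew _ Ex) (Ew _ Ey); rewrite /= !in_itv/= lee_fin => /andP[? ?] /andP[? ?].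
by rewrite ler_norml; lra.
Qed.

Lemma hausdorff1_ge0 E : (0 <= hausdorff1 E)%E.
Proof.
apply: (@le_trans _ _ (hausdorff1_pre 1 E)); last first.
  by apply: ereal_sup_ubound; exists 1 => //=; exact: ltr01.
apply: le_ereal_inf_tmp => _ [U _ <-].
by apply: nneseries_ge0 => n _ _; exact: diam_ge0.
Qed.

Lemma hausdorff1_pre_le (delta w : R) E (s : seq R) : 0 < w <= delta ->
  (forall x, E x -> exists2 p, p \in s & p <= x <= p + w) ->
  (hausdorff1_pre delta E <= ((size s)%:R * w)%:E)%E.
Proof.
move=> /andP[w0 wd] Es.
pose U k : set R :=
  if (k < size s)%N then `[nth 0 s k, nth 0 s k + w]%classic else set0.
have dU k : (diam (U k) <= w%:E)%E.
  rewrite /U; case: ifP => _; first exact: (diam_le (ltW w0) (@subset_refl _ _)).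
  exact: (@diam_le _ 0) (ltW w0) (@sub0set _ _).
apply: ge_ereal_inf; exists (\sum_(0 <= k <oo) diam (U k))%E.
  exists U => //; split => [k|x /Es[p /(nthP 0)[k ks <-] px]].
    by rewrite (le_trans (dU k))// lee_fin.
  by exists k => //; rewrite /U ks /= in_itv.
rewrite (nneseries_split _ (size s)); last by move=> k _; exact: diam_ge0.
rewrite add0n [X in (_ + X)%E]eseries0 ?adde0; last first.
  move=> k sk _; rewrite /U ltnNge sk/=; apply/eqP; rewrite eq_le diam_ge0 andbT.
  exact: (@diam_le _ 0 0) (lexx _) (@sub0set _ _).
apply: (@le_trans _ _ (\sum_(0 <= k < size s) w%:E)%E).
  by apply: lee_sum => k _; exact: dU.
by rewrite sumEFin lee_fin sum_const_seq size_iota subn0.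
Qed.

Lemma hausdorff1_le E (s : seq R) (r : R) : 0 < r ->
  (forall x, E x -> exists2 c, c \in s & `|x - c| <= r) ->
  (hausdorff1 E <= ((size s)%:R * (4 * r))%:E)%E.
Proof.
move=> r0 Es; apply: ge_ereal_sup => _ [delta /= d0 <-].
(* Pieces of total length 4 r start at c - r. Only 2 r is needed; the slack keeps the piece index
   strictly below n. *)
pose n := (Num.truncn (4 * r / delta)).+1.
have n0 : 0 < n%:R :> R by rewrite ltr0n.
pose w := 4 * r / n%:R.
have w0 : 0 < w by rewrite divr_gt0// mulr_gt0.
have wd : w <= delta.
  rewrite ler_pdivrMr// [delta * _]mulrC -ler_pdivrMr// ltW//.
  by have /andP[_] := truncn_itv (divr_ge0 (mulr_ge0 (ler0n R 4) (ltW r0)) (ltW d0)).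
have -> : (size s)%:R * (4 * r) =
    (size [seq c - r + w * i%:R | c <- s, i <- iota 0 n])%:R * w.
  rewrite size_allpairs size_iota natrM /w; field.
  by rewrite gt_eqF.
apply: hausdorff1_pre_le; first by rewrite w0.
move=> x /Es[c cs]; rewrite ler_norml => /andP[h1 h2].
have z0 : 0 <= (x - (c - r)) / w by rewrite divr_ge0 ?(ltW w0)//; lra.
have /andP[i1 i2] := truncn_itv z0; set i := Num.truncn _ in i1 i2.
have i1' : w * i%:R <= x - (c - r) by rewrite mulrC -ler_pdivlMr.
have i2' : x - (c - r) < w * i%:R + w.
  have -> : w * i%:R + w = i.+1%:R * w by rewrite -[i.+1%:R]natr1; ring.
  by rewrite -ltr_pdivrMr.
exists (c - r + w * i%:R); last by apply/andP; split; lra.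
apply/allpairsP; exists (c, i); split; [exact: cs| |by []].
rewrite mem_iota add0n leq0n andTb -(ltr_nat R); apply: le_lt_trans i1 _.
rewrite ltr_pdivrMr// /w mulrC divfK ?gt_eqF//; lra.
Qed.

(** The integral is a supremum over simple functions below the integrand. Each lies below the
    constant C, whose integral is C because P has mass 1. *)
Lemma integral_le_cst d (T : measurableType d) (P : probability T R) (D : set T)
    (f : T -> \bar R) (C : R) : 0 <= C ->
  (forall x, D x -> 0 <= f x)%E -> (forall x, D x -> f x <= C%:E)%E ->
  (\int[P]_(x in D) f x <= C%:E)%E.
Proof.
move=> C0 f0 fC; rewrite ge0_integralE//; apply: ge_ereal_sup => _ [h hf <-].
apply: (@le_trans _ _ (\int[P]_x (C%:E))%E); last first.
  by rewrite integral_cst// [X in (_ * X)%E]probability_setT mule1.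
rewrite ge0_integralTE//; apply: ereal_sup_ubound; exists h => //= x.
apply: le_trans (hf x) _; rewrite patchE; case: ifP => [/set_mem/fC//|_].
by rewrite lee_fin.
Qed.

End hausdorff_bound.

(** * Masks and projections *)

Section mask.
Context {R : realType}.
Local Open Scope complex_scope.

Definition expi (x : R) : R[i] := cos x +i* sin x.

Lemma expi0 : expi 0 = 1.
Proof. by rewrite /expi cos0 sin0. Qed.

Lemma expiD x y : expi (x + y) = expi x * expi y.
Proof. by rewrite /expi cosD sinD; congr Complex; ring. Qed.

Lemma expi_natr x n : expi (x * n%:R) = expi x ^+ n.
Proof.
elim: n => [|n IH]; first by rewrite mulr0 expi0.
by rewrite exprSr -IH -expiD -natr1 mulrDr mulr1.
Qed.

Lemma normc_expi x : Normc.normc (expi x) = 1.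
Proof. by rewrite /= cos2Dsin2 sqrtr1. Qed.

Lemma sum_expi (s : seq R) (xi : R) : \sum_(a <- s) expi (xi * a) =
  (\sum_(a <- s) cos (xi * a)) +i* (\sum_(a <- s) sin (xi * a)).
Proof.
elim: s => [|a s IH]; first by rewrite !big_nil.
by rewrite !big_cons IH.
Qed.

Lemma cos_energy_normc (s : seq R) (xi : R) :
  cos_energy s xi = Normc.normc (\sum_(a <- s) expi (xi * a)) ^+ 2.
Proof.
rewrite cos_energyE sum_expi [Normc.normc _]/= sqr_sqrtr//.
by rewrite addr_ge0 ?sqr_ge0.
Qed.

Lemma normc_ge0 (z : R[i]) : 0 <= Normc.normc z.
Proof. by case: z => a b; rewrite /= sqrtr_ge0. Qed.

Lemma normc_prod (I : Type) (r : seq I) (F : I -> R[i]) :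
  Normc.normc (\prod_(i <- r) F i) = \prod_(i <- r) Normc.normc (F i).
Proof.
elim: r => [|i r IH]; first by rewrite !big_nil Normc.normc1.
by rewrite !big_cons Normc.normcM IH.
Qed.

(* Over the algebraically closed field [R[i]] the polynomial is a product of
   factors [z - w], and [|z - w| >= | |w| - 1 |] on the circle. *)
Lemma poly_circle_lower_bound (p : {poly R[i]}) :
  (forall z, Normc.normc z = 1 -> p.[z] != 0) ->
  exists2 m, 0 < m & forall z, Normc.normc z = 1 -> m <= Normc.normc p.[z].
Proof.
move=> p0; have [r pE] := closed_field_poly_normal p.
exists (Normc.normc (lead_coef p) * \prod_(w <- r) `|Normc.normc w - 1|).
  apply: mulr_gt0.
    rewrite lt0r normc_ge0 andbT; apply/eqP => /Normc.eq0_normc /eqP.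
    rewrite lead_coef_eq0 => /eqP pp; have := p0 1 (Normc.normc1 _).
    by rewrite pp horner0 eqxx.
  rewrite big_seq; apply: prodr_gt0 => w wr; rewrite normr_gt0 subr_eq0.
  apply/eqP => /p0; rewrite pE hornerZ horner_prod (big_rem w)//=.
  by rewrite hornerXsubC subrr mul0r mulr0 eqxx.
move=> z z1; rewrite {2}pE hornerZ Normc.normcM ler_wpM2l ?normc_ge0//.
rewrite horner_prod normc_prod; apply: ler_prod => w _.
rewrite normr_ge0 hornerXsubC -z1 ler_norml /=; apply/andP; split.
  have := le_normcD (z - w) w; rewrite subrK; lra.
have := le_normcD (w - z) z; rewrite subrK -(normcN (w - z)) opprB; lra.
Qed.

Lemma mask_min_gt0 (L : nat) (B : {set 'I_L}) :
  (forall z : R[i], Normc.normc z = 1 -> (mask_poly R B).[z] != 0) ->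
  0 < mask_min R B.
Proof.
move=> /poly_circle_lower_bound[m m0 hm]; apply: lt_le_trans m0 _.
apply: lb_le_inf; last by move=> _ [z /= z1 <-]; exact: hm.
by exists (Normc.normc (mask_poly R B).[1]); exists 1 => //=; exact: Normc.normc1.
Qed.

Lemma mask_min_le (L : nat) (B : {set 'I_L}) (z : R[i]) : Normc.normc z = 1 ->
  mask_min R B <= Normc.normc (mask_poly R B).[z].
Proof.
move=> z1; apply: ge_inf; last by exists z.
by exists 0 => _ [w _ <-]; exact: normc_ge0.
Qed.

Lemma horner_mask (L : nat) (B : {set 'I_L}) (z : R[i]) :
  (mask_poly R B).[z] = \sum_(a in B) z ^+ a.
Proof. by rewrite horner_sum; apply: eq_bigr => a _; rewrite hornerXn. Qed.

End mask.

(** * Projections of the Cantor set *)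

Section projected_digits.
Context {R : realType} (d L : nat) (A : 'I_d -> {set 'I_L}).
Implicit Types (theta : 'rV[R]_d) (n N : nat).

Local Notation digit_vectors := (family (fun i => mem (A i))).

(** Dividing by this brings the projected digits into [-1/4, 1/4]. *)
Let Lambda : R := 4 * d%:R * L%:R.

Definition projected_digit theta (f : 'I_d -> 'I_L) : R :=
  Lambda^-1 * \sum_(i < d) theta ord0 i * (f i)%:R.

(** Digit vectors with equal projections are listed separately, so that the size is the same for
    every theta. *)
Definition projected_digits theta : seq R :=
  [seq projected_digit theta f | f : {ffun 'I_d -> 'I_L} in digit_vectors].

Lemma size_projected_digits theta :
  size (projected_digits theta) = (\prod_(i < d) #|A i|)%N.
Proof.
rewrite size_image -sum1_card.
under [RHS]eq_bigr do rewrite -sum1_card.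
by rewrite bigA_distr_big_dep/=; apply: eq_bigr => f _; rewrite big1.
Qed.

(** Expanding the product over coordinates enumerates the digit vectors: this is the independence of
    the coordinates. *)
Lemma sum_projected_digits theta (xi : R) :
  \sum_(a <- projected_digits theta) expi (xi * a) =
  \prod_(i < d) (mask_poly R (A i)).[expi (xi * Lambda^-1 * theta ord0 i)].
Proof.
under [RHS]eq_bigr do rewrite horner_mask.
rewrite bigA_distr_big_dep/= big_image/=; apply: eq_bigr => f _.
rewrite /projected_digit mulrA mulr_sumr (big_morph _ expiD expi0).
by apply: eq_bigr => i _; rewrite mulrA expi_natr.
Qed.

Definition mask_ratio : R := \prod_(i < d) (#|A i|%:R / mask_min R (A i)).

Hypothesis prodA : (\prod_(i < d) #|A i|)%N = L.
Hypothesis mask0 : forall (i : 'I_d) (z : R[i]),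
  Normc.normc z = 1 -> (mask_poly R (A i)).[z] != 0.

(** Every factor in [sum_projected_digits] is a mask polynomial on the unit circle, hence at least
    its [mask_min] in modulus. This provides [kappa_t] with the square of [mask_ratio]. *)
Lemma mask_ratio_cos_energy theta xi :
  L%:R ^+ 2 <= mask_ratio ^+ 2 * cos_energy (projected_digits theta) xi.
Proof.
pose m : R := \prod_(i < d) mask_min R (A i).
have m0 : 0 < m by apply: prodr_gt0 => i _; exact: (mask_min_gt0 (@mask0 i)).
have -> : mask_ratio = L%:R / m.
  by rewrite /mask_ratio big_split/= prodfV -natr_prod prodA.
rewrite cos_energy_normc sum_projected_digits normc_prod exprMn -mulrA.
rewrite ler_peMr ?sqr_ge0// mulrC exprVn ler_pdivlMr ?exprn_gt0// mul1r.
rewrite lerXn2r ?nnegrE ?(ltW m0)//.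
  by apply: prodr_ge0 => i _; exact: normc_ge0.
apply: ler_prod => i _; rewrite (ltW (mask_min_gt0 (@mask0 i)))/=.
by rewrite mask_min_le// normc_expi.
Qed.

Hypothesis d2 : (2 <= d)%N.
Hypothesis L4 : (4 <= L)%N.

Let d1 : 2 <= d%:R :> R. Proof. by rewrite ler_nat. Qed.
Let l4 : 4 <= L%:R :> R. Proof. by rewrite ler_nat. Qed.

Let Lambda_gt0 : 0 < Lambda.
Proof. by move: d1 l4 => ? ?; rewrite !mulr_gt0//; lra. Qed.

Lemma projected_digits_le theta : (forall i, `|theta ord0 i| <= 1) ->
  {in projected_digits theta, forall a, `|a| <= 1 / 4}.
Proof.
move=> th1 _ /fintype.imageP[f _ ->].
rewrite normrM gtr0_norm ?invr_gt0// mulrC ler_pdivrMr//.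
have -> : 1 / 4 * Lambda = \sum_(i < d) L%:R.
  by rewrite big_const_ord iter_addr_0 -mulr_natr /Lambda; field.
apply: le_trans (ler_norm_sum _ _ _) _; apply: ler_sum => i _.
rewrite normrM normr_nat -[leRHS]mul1r ler_pM// ler_nat ltnW//.
Qed.

Lemma mem_points_projected theta (alpha : nat -> 'I_d -> 'I_L) n :
  (forall k i, alpha k i \in A i) ->
  \sum_(0 <= k < n) L%:R ^- k.+1 * projected_digit theta (alpha k) \in
  points L (projected_digits theta) n.
Proof.
elim: n alpha => [|n IH] alpha hA; first by rewrite big_nil mem_head.
rewrite big_nat_recl//=.
have := IH (fun k => alpha k.+1) (fun k => hA k.+1).
set y := \sum_(0 <= k < n) _ => yn; apply/allpairsP.
exists (projected_digit theta (alpha 0), y); split => //=.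
  apply/fintype.imageP; exists [ffun i => alpha 0 i].
    by apply/familyP => i; rewrite ffunE; exact: hA.
  by congr (_ * _); apply: eq_bigr => i _; rewrite ffunE.
rewrite mulrDr expr1; congr (_ + _); rewrite mulr_sumr; apply: eq_bigr => k _.
by rewrite mulrA -invfM -exprS.
Qed.

Let partial (alpha : nat -> 'I_d -> 'I_L) n : 'rV[R]_d :=
  series (fun k => L%:R ^- k.+1 *: \row_i (alpha k i)%:R) n.

Lemma partial_coord alpha n i :
  partial alpha n ord0 i = \sum_(0 <= k < n) L%:R ^- k.+1 * (alpha k i)%:R.
Proof.
rewrite /partial /series/= summxE; apply: eq_bigr => k _.
by rewrite !mxE.
Qed.

Lemma partial_tail alpha N n i : (N <= n)%N ->
  `|partial alpha n ord0 i - partial alpha N ord0 i| <= L%:R ^- N.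
Proof.
have l0 k : 0 < (L%:R : R) ^+ k by exact: exprL_gt0.
move=> Nn; rewrite !partial_coord (@big_cat_nat _ _ _ N)//= addrAC subrr add0r.
rewrite ger0_norm; last by rewrite sumr_ge0// => k _; rewrite mulr_ge0// invr_ge0 ltW.
(* Digits are at most L - 1, so the tail is dominated by a telescoping sum. *)
apply: (@le_trans _ _ (\sum_(N <= k < n) (L%:R ^- k - L%:R ^- k.+1))).
  apply: ler_sum => k _.
  have -> : L%:R ^- k - L%:R ^- k.+1 = L%:R ^- k.+1 * (L%:R - 1) :> R.
    rewrite mulrBr mulr1; congr (_ - _); rewrite exprS invfM mulrAC mulVf ?mul1r//.
    by rewrite gt_eqF//; have := l4; lra.
  rewrite ler_pM2l ?invr_gt0// lerBrDr natr1 ler_nat.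
  exact: ltn_ord.
have := telescope_sumr (fun k => - L%:R ^- k : R) Nn.
under eq_bigr do rewrite opprK addrC.
by move=> ->; rewrite opprK gerDr oppr_le0 invr_ge0 ltW.
Qed.

Lemma cantor_dist N y : cantor_product R A y ->
  exists2 alpha : nat -> 'I_d -> 'I_L, (forall k i, alpha k i \in A i) &
    forall i, `|y ord0 i - partial alpha N ord0 i| <= L%:R ^- N.
Proof.
move=> [alpha hA cy]; exists alpha => // i; rewrite distrC.
have ci : (partial alpha n ord0 i) @[n --> \oo] --> y ord0 i.
  apply: (@continuous_cvg _ _ _ _ _ (partial alpha)
    (fun M : 'rV[R]_d => M ord0 i)); last exact: cy.
  exact: coord_continuous.
have ca : `|partial alpha N ord0 i - partial alpha n ord0 i| @[n --> \oo] -->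
    `|partial alpha N ord0 i - y ord0 i|.
  by apply: cvg_norm; apply: cvgB => //; exact: cvg_cst.
apply: (cvgr_to_le ca); exists N => // n /= Nn.
by rewrite distrC partial_tail.
Qed.

Lemma dotp_partial theta alpha N : dotp theta (partial alpha N) =
  Lambda * \sum_(0 <= k < N) L%:R ^- k.+1 * projected_digit theta (alpha k).
Proof.
rewrite /dotp; under eq_bigr do rewrite partial_coord mulr_sumr.
rewrite exchange_big/= mulr_sumr; apply: eq_bigr => k _.
rewrite /projected_digit mulrCA [Lambda * _]mulrA divff ?gt_eqF// mul1r.
by rewrite mulr_sumr; apply: eq_bigr => i _; rewrite mulrCA.
Qed.

Lemma coord_le_enorm (x : 'rV[R]_d) i : `|x ord0 i| <= enorm x.
Proof.
rewrite -sqrtr_sqr ler_wsqrtr// /dotp (bigD1 i)//= expr2 lerDl.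
by rewrite sumr_ge0// => j _; rewrite -expr2 sqr_ge0.
Qed.

(** Each coordinate errs by at most 2 L^-N, half from the neighbourhood and half from truncating the
    digits, and 2 d <= Lambda. *)
Lemma projection_near theta N x : (forall i, `|theta ord0 i| <= 1) ->
  thickening (L%:R ^- N) (cantor_product R A) x ->
  exists2 p, p \in points L (projected_digits theta) N &
    `|dotp theta x - Lambda * p| <= Lambda * L%:R ^- N.
Proof.
move=> th1 [y /(cantor_dist N)[alpha hA hy] xy].
exists (\sum_(0 <= k < N) L%:R ^- k.+1 * projected_digit theta (alpha k)).
  exact: mem_points_projected.
have l0 : 0 < (L%:R : R) ^- N by rewrite invr_gt0 exprL_gt0.
rewrite -dotp_partial /dotp -sumrB; apply: le_trans (ler_norm_sum _ _ _) _.
apply: (@le_trans _ _ (\sum_(i < d) 2 * L%:R ^- N)).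
  apply: ler_sum => i _; rewrite -mulrBr normrM.
  apply: (@le_trans _ _ (1 * `|x ord0 i - partial alpha N ord0 i|)).
    by rewrite ler_wpM2r.
  rewrite mul1r.
  have := ler_normD (x ord0 i - y ord0 i) (y ord0 i - partial alpha N ord0 i).
  rewrite addrA subrK; have := hy i; have := coord_le_enorm (x - y) i.
  by rewrite !mxE; move: xy l0; set q := _ ^- N; lra.
have -> : \sum_(i < d) 2 * L%:R ^- N = 2 * d%:R * L%:R ^- N :> R.
  by rewrite big_const_ord iter_addr_0; ring.
by rewrite ler_pM2r// /Lambda; have := d1; have := l4; nra.
Qed.

Lemma hausdorff1_projection_le theta N (r : R) : (forall i, `|theta ord0 i| <= 1) ->
  covered L N (points L (projected_digits theta) N) (r * L%:R ^+ N) ->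
  (hausdorff1 (dotp theta @` thickening (L%:R ^- N) (cantor_product R A)) <=
   (32 * d%:R * L%:R * r)%:E)%E.
Proof.
move=> th1 [s sr hs].
have l0 : 0 < (L%:R : R) ^+ N by rewrite exprL_gt0.
have l0' : 0 < (L%:R : R) ^- N by rewrite invr_gt0.
(* The radius adds Lambda L^-N from [projection_near] and as much from the cover of the digit
   points. *)
have r0 : 0 < 2 * Lambda * L%:R ^- N.
  by rewrite mulr_gt0// mulr_gt0.
apply: (@le_trans _ _ ((size [seq Lambda * c | c <- s])%:R *
    (4 * (2 * Lambda * L%:R ^- N)))%:E).
  apply: hausdorff1_le r0 _.
  move=> _ [x /(projection_near th1)[p pp xp] <-].
  have [c cs pc] := hs p pp; exists (Lambda * c); first exact: map_f.
  have := ler_normD (dotp theta x - Lambda * p) (Lambda * (p - c)).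
  rewrite mulrBr addrA subrK -mulrBr [`|Lambda * _|]normrM gtr0_norm//.
  have : Lambda * `|p - c| <= Lambda * L%:R ^- N by rewrite ler_pM2l.
  lra.
rewrite size_map lee_fin.
have -> : 32 * d%:R * L%:R * r =
    (r * L%:R ^+ N) * (4 * (2 * Lambda * L%:R ^- N)).
  by rewrite /Lambda; field; rewrite gt_eqF.
by rewrite ler_wpM2r// mulr_ge0// ltW.
Qed.

Lemma mask_quotient_gt0 i : 0 < #|A i|%:R / mask_min R (A i).
Proof.
rewrite divr_gt0 ?(mask_min_gt0 (@mask0 i))//.
rewrite ltr0n lt0n; apply/eqP => Ai0.
by move: L4; rewrite -prodA (bigD1 i)//= Ai0 mul0n.
Qed.

Lemma mask_ratio_gt0 : 0 < mask_ratio.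
Proof. by apply: prodr_gt0 => i _; exact: mask_quotient_gt0. Qed.

Lemma mask_ratio_powR : L%:R `^ mask_exponent R A = mask_ratio.
Proof.
have l1 : 1 < (L%:R : R) by have := l4; lra.
rewrite /powR gt_eqF; last by lra.
have -> : mask_exponent R A * ln L%:R = ln mask_ratio.
  rewrite /mask_exponent /log_base -mulr_suml mulfVK ?gt_eqF ?ln_gt0//.
  pose F i := #|A i|%:R / mask_min R (A i).
  suff [] : 0 < \prod_(i < d) F i /\
    \sum_(i < d) ln (F i) = ln (\prod_(i < d) F i) by [].
  elim/big_rec2 : _ => [|i x y _ [x0 ->]]; first by rewrite ln1.
  have Fi : 0 < F i := mask_quotient_gt0 i.
  by rewrite mulr_gt0//; split => //; rewrite (lnM (_ : F i \in _) (_ : y \in _)) ?posrE.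
by rewrite lnK ?posrE ?mask_ratio_gt0.
Qed.

End projected_digits.

Theorem corollary8p4 (R : realType) (d L : nat) (A : 'I_d -> {set 'I_L})
    (hd : (2 <= d)%N) (hL : (4 <= L)%N)
    (hprod : (\prod_(i < d) #|A i|)%N = L)
    (hA2 : exists i j : 'I_d, [/\ i != j, (2 <= #|A i|)%N & (2 <= #|A j|)%N])
    (hmask : forall (i : 'I_d) (z : R[i]),
       Normc.normc z = 1 -> (mask_poly R (A i)).[z] != 0)
    (u : R) (hu : 0 < u) :
  exists C : R, forall N : nat, (1 <= N)%N ->
    (favard (thickening (L%:R ^- N) (cantor_product R A)) <=
     (C * N%:R `^ (- 1 / (2 * mask_exponent R A + 1) + u))%:E)%E.
Proof.
have L4R : 4 <= L%:R :> R by rewrite ler_nat.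
have l0 : 0 < L%:R :> R by lra.
pose kappa := mask_ratio (R := R) A ^+ 2.
have kt theta xi : L%:R ^+ 2 <= kappa * cos_energy (projected_digits A theta) xi.
  exact: mask_ratio_cos_energy.
have st theta : size (projected_digits (R := R) A theta) = L.
  by rewrite size_projected_digits.
have k1 : 1 <= kappa := kappa_ge1 (st 0) hL (kt 0).
have r0 : 0 < mask_ratio (R := R) A by exact: mask_ratio_gt0.
have r1 : 1 <= mask_ratio (R := R) A.
  by rewrite -(ler_sqr _ _) ?nnegrE ?expr1n// ltW.
have lD : L%:R `^ mask_exponent R A = mask_ratio A by exact: mask_ratio_powR.
set D := mask_exponent R A in lD *.
have D0 : 0 <= D.
  have : 0 <= D * ln (L%:R : R) by rewrite -ln_powR lD ln_ge0.
  by rewrite pmulr_lge0// ln_gt0//; lra.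
pose p := (2 * D + 1)^-1.
have p01 : 0 < p <= 1.
  by rewrite invr_gt0 invf_le1; lra.
(* This fixes the exponent: kappa = L^(2 D), so L kappa = L^(2 D + 1). *)
have bp : (L%:R * kappa) `^ p = L%:R.
  have -> : L%:R * kappa = L%:R `^ (2 * D + 1).
    rewrite powRD; last by rewrite (gt_eqF l0) implybT.
    by rewrite powRr1 ?ltW// mulrC [2 * D]mulrC powRrM lD powR_mulrn// ltW.
  by rewrite -powRrM mulfV ?powRr1 ?(ltW l0)// gt_eqF//; lra.
have l1 : 1 < L%:R :> R by lra.
have b1 : 1 < L%:R * kappa by rewrite (lt_le_trans l1)// ler_peMr// ltW.
have a1 : 1 <= 3 * L%:R ^+ 2 :> R.
  have : 1 <= L%:R ^+ 2 :> R by rewrite exprn_ege1// ltW.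
  lra.
(* The constant is chosen before theta, which makes the bound uniform over directions. *)
have [c c0 cov] : exists2 c : R, 0 <= c & forall (theta : 'rV[R]_d) m N,
    (forall i, `|theta ord0 i| <= 1) ->
    3 * L%:R ^+ 2 * m%:R ^+ 2 * (L%:R * kappa) ^+ m <= N%:R ->
    covered L N (points L (projected_digits A theta) N) (c / L%:R ^+ m * L%:R ^+ N).
  exists 6148 => [|theta m N th1 mN]; first exact: ler0n.
  have t4 := @projected_digits_le R d L A hd hL theta th1.
  exact: (covered_scale (st theta) hL t4 (kt theta) mN).
have [C C0 hC] := choose_scale l1 b1 bp p01 hu a1.
exists (32 * d%:R * L%:R * (c * C)) => N N1.
have [m mN mC] := hC N N1.
have -> : - 1 / (2 * D + 1) = - p by rewrite mulN1r.
apply: integral_le_cst => [|theta _|theta theta1].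
- by rewrite !mulr_ge0// powR_ge0.
- exact: hausdorff1_ge0.
have th1 i : `|theta ord0 i| <= 1 by rewrite -theta1 coord_le_enorm.
have := cov _ _ _ th1 mN.
move=> /(hausdorff1_projection_le hd hL th1) /le_trans; apply.
by rewrite lee_fin -!mulrA !ler_wpM2l.
Qed.
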